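(* Let $\Phi\subseteq\mathcal{P}(\mathcal{X})$ and let $Q\subset\Phi$ be an open set. Let $X_1^n$ be a sample of size $n$ drawn from a multicolor Pólya urn with parameter $c\in\mathbb{Z}$ and true initial configuration $r(N)$, where $N=N(n)$. Let $\beta(n) = \frac{n}{N}\to\beta\in(0,1)$ and $r(N)\to r\in\mathcal{P}(\mathcal{X})$ (in total variation) as $n\to\infty$. Let $L_\beta^c(Q\,\|\,r)<\infty$. Then, with probability one, $$\lim_{n\to\infty}\frac1n\log\Pi_n(q(N)\in Q\,|\,X_1^n;c) = -\{L_\beta^c(Q\,\|\,r) - L_\beta^c(\Phi\,\|\,r)\}.$$
   Context: $\mathcal{X} = \{x_1,\ldots,x_m\}$ is a finite set (of colors) and $\mathcal{P}(\mathcal{X})$ is the set of all probability mass functions with support $\mathcal{X}$; topological notions refer to the topology induced on the $m$-dimensional simplex by the usual topology on $\mathbb{R}^m$. Pólya sampling: an urn initially contains $N$ balls, $\alpha_i$ of color $x_i$, with initial configuration $q(N) = (\alpha_1,\ldots,\alpha_m)/N$; after each draw the drawn ball is returned together with $c\in\mathbb{Z}$ additional balls of the same color ($c$ negative means removal). The probability of a sample $X_1^n = (X_1,\ldots,X_n)$ in which color $x_i$ occurs $n_i$ times is given by $$\log\Pi(X_1^n\,|\,q(N);c) = \sum_{i=1}^m\sum_{l=0}^{n_i-1}\log(\alpha_i+lc) - \sum_{l=0}^{n-1}\log(N+lc),$$ which is meaningful if $-nc\le\min(\alpha_1,\ldots,\alpha_m)$ (this is assumed). Bayesian setting: $\Phi(N)$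 denotes the intersection of $\Phi$ with the set of all possible configurations of the $N$-urn. A prior distribution $\Pi(q(N))$ of initial configurations $q(N)$ has support $\Phi(N)$. The true initial configuration $r(N)$ is not necessarily in $\Phi(N)$. The posterior is $$\Pi_n(q(N)\in Q\,|\,X_1^n;c) = \frac{\sum_{q(N)\in Q\cap\Phi(N)}\Pi(q(N))\,\Pi(X_1^n\,|\,q(N);c)}{\sum_{q(N)\in\Phi(N)}\Pi(q(N))\,\Pi(X_1^n\,|\,q(N);c)}.$$ For $p,q\in\mathcal{P}(\mathcal{X})$ the Pólya $L$-divergence of $q$ with respect to $p$ is, for $c\neq0$, $$L_\beta^c(q\,\|\,p) = -\sum_{i=1}^m p_i\log(q_i+\beta c p_i) + \frac{1}{\beta c}\sum_{i=1}^m q_i\log\frac{q_i}{q_i+\beta c p_i},$$ and, by continuity, $L_\beta^0(q\,\|\,p) = -\sum_{i=1}^m p_i\log q_i - 1$. A Pólya $L_\beta^c$-projection of $p$ on $A\subseteq\mathcal{P}(\mathcal{X})$ is $\hat q = \arg\inf_{q\in A}L_\beta^c(q\,\|\,p)$, and $L_\beta^c(A\,\|\,p)$ denotes the value of the $L_\beta^c$-divergence at an $L_\beta^c$-projection of $p$ on $A$, i.e. $\inf_{q\in A}L_\beta^c(q\,\|\,p)$.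
   Formalization: Added assumption on the priors: for every q in Φ, every neighborhood U of q and every ε>0, the prior mass of U∩Φ(N(n)) is at least exp(-εn) for all large n; without it the claim fails, e.g. for priors of mass at most exp(-N²) outside Q. *)

(* Defs.v *)
From HB Require Import structures.
From mathcomp Require Import all_boot all_order all_algebra.
From mathcomp Require Import all_classical all_reals all_analysis.
Set Implicit Arguments.
Unset Strict Implicit.
Unset Printing Implicit Defensive.
Import Order.TTheory GRing.Theory Num.Theory.
Import numFieldNormedType.Exports.
Local Open Scope classical_set_scope.
Local Open Scope ring_scope.

(* Probability mass functions on m colors whose support is the whole set of
   colors; all entries are therefore nonzero. *)
Definition full_pmf (R : realType) (m : nat) : set 'rV[R]_m :=
  [set q | (forall i, 0 < q 0 i) /\ \sum_i q 0 i = 1].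

Definition tv_dist (R : realType) (m : nat) (p q : 'rV[R]_m) : R :=
  2^-1 * \sum_i `|p 0 i - q 0 i|.

(* The urn with M balls, alpha i of them of color i, is represented by the row
   (alpha i / M)_i; alpha i is recovered as M%:R * q 0 i. *)
Definition urn_config (R : realType) (m M : nat) : set 'rV[R]_m :=
  [set q | (0 < M)%N /\
     exists alpha : 'I_m -> nat,
       (\sum_i alpha i = M)%N /\ q = \row_i ((alpha i)%:R / M%:R)].

(* - n c <= min_i alpha_i: the urn supports n draws with parameter c. *)
Definition polya_admissible (R : realType) (m : nat) (c : int) (n M : nat)
    (q : 'rV[R]_m) : Prop :=
  forall i, - (n%:R * c%:~R) <= M%:R * q 0 i.

(* Written as a product, so that colors absent from the urn (alpha_i = 0) are
   covered too; ln_polya_prob is the logarithmic form. *)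
Definition polya_prob (R : realType) (m : nat) (c : int) (n M : nat)
    (q : 'rV[R]_m) (x : n.-tuple 'I_m) : R :=
  (\prod_i \prod_(l < count_mem i x) (M%:R * q 0 i + l%:R * c%:~R))
  / \prod_(l < n) (M%:R + l%:R * c%:~R).

Lemma ln_polya_prob (R : realType) (m : nat) (c : int) (n M : nat)
    (q : 'rV[R]_m) (x : n.-tuple 'I_m) :
  (forall i (l : 'I_(count_mem i x)), 0 < M%:R * q 0 i + l%:R * c%:~R) ->
  (forall l : 'I_n, 0 < M%:R + l%:R * c%:~R :> R) ->
  ln (polya_prob c M q x) =
    \sum_i \sum_(l < count_mem i x) ln (M%:R * q 0 i + l%:R * c%:~R)
    - \sum_(l < n) ln (M%:R + l%:R * c%:~R).
Proof.
move=> hq hM.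
have lnprod (I : finType) (F : I -> R) :
    (forall i, 0 < F i) -> ln (\prod_i F i) = \sum_i ln (F i).
  move=> F0; suff [] : 0 < \prod_i F i /\ ln (\prod_i F i) = \sum_i ln (F i).
    by [].
  apply: (big_rec2 (fun a b => 0 < b /\ ln b = a)) => [|i a b _ [b0 <-]].
    by rewrite ln1.
  by rewrite mulr_gt0 // lnM ?posrE.
rewrite /polya_prob ln_div ?posrE; last 2 first.
- by apply: prodr_gt0 => i _; apply: prodr_gt0.
- exact: prodr_gt0.
rewrite !lnprod //; last by move=> i; apply: prodr_gt0.
by congr (_ - _); apply: eq_bigr => i _; rewrite lnprod.
Qed.

(* Row n is a sample of size n from the urn r_ (N n) with N n balls; nothing is
   assumed about the joint law of samples of different sizes. *)
Definition polya_samples (d : measure_display) (Omega : measurableType d)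
    (R : realType) (P : probability Omega R) (m : nat) (c : int)
    (N : nat -> nat) (r_ : nat -> 'rV[R]_m)
    (X : forall n : nat, Omega -> n.-tuple 'I_m) : Prop :=
  forall n, (0 < n)%N -> forall x : n.-tuple 'I_m,
    measurable (X n @^-1` [set x]) /\
    P (X n @^-1` [set x]) = (polya_prob c (N n) (r_ (N n)) x)%:E.

Definition urn_restrict (R : realType) (m : nat) (Phi : set 'rV[R]_m) (M : nat)
    : set 'rV[R]_m :=
  Phi `&` urn_config M.

Definition prior_with_support (R : realType) (m : nat) (A : set 'rV[R]_m)
    (prior : 'rV[R]_m -> R) : Prop :=
  [/\ forall q, 0 <= prior q, forall q, A q <-> prior q != 0
    & \sum_(q \in A) prior q = 1].

(* The support condition on the priors in the limit: no neighborhood of a point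
   of Phi has exponentially small prior mass. A prior that does not vary with n
   has this property exactly when Phi is contained in its topological support.
   Positivity of every prior on Phi(N) does not entail it: the prior weights may
   decay like exp (- N ^ 2), and an isolated point of Phi with an irrational
   coordinate lies in no Phi(N). *)
Definition prior_charges (R : realType) (m : nat) (Phi : set 'rV[R]_m)
    (N : nat -> nat) (prior : nat -> 'rV[R]_m -> R) : Prop :=
  forall q, Phi q -> forall U : set 'rV[R]_m, nbhs q U ->
  forall eps : R, 0 < eps -> \forall n \near \oo,
    expR (- (eps * n%:R)) <=
      \sum_(q' \in U `&` urn_restrict Phi (N n)) prior (N n) q'.

Definition polya_posterior (R : realType) (m : nat) (Phi : set 'rV[R]_m)
    (c : int) (n M : nat) (prior : 'rV[R]_m -> R) (x : n.-tuple 'I_m)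
    (Q : set 'rV[R]_m) : R :=
  (\sum_(q \in Q `&` urn_restrict Phi M) (prior q * polya_prob c M q x))
  / \sum_(q \in urn_restrict Phi M) (prior q * polya_prob c M q x).

(* The divergence of q with respect to p; for c < 0 it is meaningful when every
   q_i + beta c p_i is positive. *)
Definition polya_L (R : realType) (m : nat) (c : int) (beta : R)
    (q p : 'rV[R]_m) : R :=
  if c == 0 then - (\sum_i p 0 i * ln (q 0 i)) - 1
  else - (\sum_i p 0 i * ln (q 0 i + beta * c%:~R * p 0 i))
       + (beta * c%:~R)^-1 *
         \sum_i q 0 i * ln (q 0 i / (q 0 i + beta * c%:~R * p 0 i)).

Definition polya_L_inf (R : realType) (m : nat) (c : int) (beta : R)
    (A : set 'rV[R]_m) (p : 'rV[R]_m) : \bar R :=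
  ereal_inf [set (polya_L c beta q p)%:E | q in A].

(* Main.v *)
(** Up to a factor that does not depend on [q], the probability of the sample is
    [exp (n g_n(q))], where [g_n(q)] is a sum over colors of Riemann sums of
    [t |-> ln (q_i + beta c t)] over [0, r_i] as soon as the observed
    frequencies tend to [r]. Comparing with the primitive [x ln x - x] of [ln],
    [g_n] tends to [H = - L - 1] uniformly on [Phi(N)]; the Laplace principle
    then gives [sup_Q H - sup_Phi H] as the exponential rate of the posterior.
    The frequencies converge almost surely because the centered count divided
    by the current number of balls is a martingale with increments [O(1/N)]:
    its exponential moments give geometric tails, and Borel-Cantelli applies
    whatever the joint law of the rows is. *)
Require Import Defs.
From HB Require Import structures.
From mathcomp Require Import all_boot all_order all_algebra.
From mathcomp Require Import all_classical all_reals all_analysis.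
From mathcomp Require Import ring lra.
Set Implicit Arguments.
Unset Strict Implicit.
Unset Printing Implicit Defensive.
Import Order.TTheory GRing.Theory Num.Theory.
Import numFieldNormedType.Exports.
Local Open Scope classical_set_scope.
Local Open Scope ring_scope.

(** * Riemann sums of the logarithm *)

(** The obstacle is uniformity in [q], since [ln] is unbounded near the faces of the simplex. For
    [c != 0], a positive entry of a configuration is at least [1 / N], so the end of the Riemann sum
    at [q_i] costs at most [ln N], which is [o(n)] because [N = O(n)]; the other end,
    [q_i + beta c r_i], is kept away from [0], and [x ln x - x] itself stays bounded near [0]. The
    exponential tails require every ball total [N + l c] with [l <= n] to be at least [n]; for
    [c < 0] this is obtained from admissibility in two distinct colors. The constant [1] in [H] is
    the sum of the [r_i], produced by the linear part of [x ln x - x]; it cancels in the rate. *)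

Definition xlnx (R : realType) (x : R) : R := x * ln x - x.

(** Tangent inequality for the convex primitive of [ln], obtained from [ln (1 + z) <= z] at
    [z = x / y - 1]; the right bound is the left one with [x] and [y] exchanged. *)
Lemma xlnx_slope (R : realType) (x y : R) : 0 < x -> 0 < y ->
  (y - x) * ln x <= xlnx y - xlnx x <= (y - x) * ln y.
Proof.
have half (u v : R) : 0 < u -> 0 < v ->
    (v - u) * ln u <= xlnx v - xlnx u.
  move=> u0 v0; rewrite /xlnx.
  have uv0 : 0 < u / v by rewrite divr_gt0.
  have := @le_ln1Dx R (u / v - 1); rewrite [1 + _]addrC subrK.
  rewrite ltrBDl subrr => /(_ uv0).
  rewrite ln_div ?posrE // => h.
  have : v * (ln u - ln v) <= v * (u / v - 1) by rewrite ler_pM2l.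
  have -> : v * (u / v - 1) = u - v by field; rewrite gt_eqF.
  move: h => _; set a := ln u; set b := ln v; nra.
move=> x0 y0; rewrite half //=.
by have := half _ _ y0 x0; nra.
Qed.

Lemma ler_norm_ln (R : realType) (d B x : R) : 0 < d -> d <= x <= B ->
  `|ln x| <= `|ln d| + `|ln B|.
Proof.
move=> d0 /andP[dx xB].
have : ln d <= ln x by rewrite ler_ln ?posrE//; lra.
have : ln x <= ln B by rewrite ler_ln ?posrE//; lra.
have := ler_norm (ln B); have := ler_norm (- ln d); rewrite normrN.
have := normr_ge0 (ln B); have := normr_ge0 (ln d).
by move=> *; rewrite ler_norml; apply/andP; split; lra.
Qed.

Lemma xlnx_lipschitz (R : realType) (d B x y : R) :
  0 < d -> d <= x <= B -> d <= y <= B ->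
  `|xlnx y - xlnx x| <= (`|ln d| + `|ln B|) * `|y - x|.
Proof.
move=> d0 /andP[dx xB] /andP[dy yB].
have x0 : 0 < x by lra.
have y0 : 0 < y by lra.
have /andP[lo hi] := xlnx_slope x0 y0.
have hx : `|ln x| <= `|ln d| + `|ln B| by apply: ler_norm_ln => //; rewrite dx.
have hy : `|ln y| <= `|ln d| + `|ln B| by apply: ler_norm_ln => //; rewrite dy.
have pr u : `|u| <= `|ln d| + `|ln B| ->
    `|(y - x) * u| <= (`|ln d| + `|ln B|) * `|y - x|.
  by move=> hu; rewrite normrM mulrC ler_wpM2r.
move: (pr _ hx) (pr _ hy); rewrite !ler_norml => /andP[? ?] /andP[? ?].
by apply/andP; split; lra.
Qed.

(** The bound does not degrade as [x] tends to [0]: the slope inequality at [1] gives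
    [-1 <= xlnx x]. *)
Lemma xlnx_bounded (R : realType) (B x : R) : 0 < x <= B ->
  `|xlnx x| <= 1 + B * `|ln B|.
Proof.
move=> /andP[x0 xB]; have B0 : 0 < B by lra.
have /andP[lo _] := xlnx_slope (@ltr01 R) x0.
rewrite /xlnx !ln1 !mulr0 in lo; rewrite /xlnx.
have h : ln x <= ln B by rewrite ler_ln.
have h2 := ler_norm (ln B).
have : x * ln x <= B * `|ln B|.
  apply: (@le_trans _ _ (x * `|ln B|)); first by rewrite ler_pM2l //; lra.
  by rewrite ler_wpM2r.
have : 0 <= B * `|ln B| by rewrite mulr_ge0 // ltW.
by rewrite ler_norml => *; apply/andP; split; lra.
Qed.

(* Telescoping [xlnx_slope]; valid for steps [h] of either sign. *)
Lemma sum_ln_xlnx (R : realType) (s h : R) (k : nat) :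
  (forall l, (l <= k)%N -> 0 < s + l%:R * h) ->
  `|h * (\sum_(l < k) ln (s + l%:R * h)) - (xlnx (s + k%:R * h) - xlnx s)|
    <= `|h * (ln (s + k%:R * h) - ln s)|.
Proof.
move=> pos.
suff /andP[lo hi] : h * (\sum_(l < k) ln (s + l%:R * h)) <=
    xlnx (s + k%:R * h) - xlnx s
    <= h * (\sum_(l < k) ln (s + l%:R * h)) + h * (ln (s + k%:R * h) - ln s).
  rewrite distrC ger0_norm ?subr_ge0 //.
  by apply: le_trans (ler_norm _); rewrite lerBlDl.
elim: k pos => [|k IH] pos.
  by rewrite big_ord0 mul0r addr0 !subrr !mulr0 addr0 lexx.
have /andP[IH1 IH2] := IH (fun l lk => pos l (leqW lk)).
rewrite big_ord_recr /=.
have := xlnx_slope (pos k (leqnSn _)) (pos k.+1 (leqnn _)).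
have -> : s + k.+1%:R * h - (s + k%:R * h) = h by rewrite -natr1; ring.
by move=> /andP[? ?]; apply/andP; split; lra.
Qed.

(** [expR (e n)] is at least [(e n / 2) ^ 2], which outgrows [B n]. This absorbs the logarithm of
    the smallest positive entry of a configuration. *)
Lemma ln_natr_sublinear (R : realType) (B : R) (N : nat -> nat) :
  (\forall n \near \oo, (0 < N n)%N /\ (N n)%:R <= B * n%:R) ->
  forall e : R, 0 < e -> \forall n \near \oo, ln ((N n)%:R) <= e * n%:R.
Proof.
move=> hN e e0.
near=> n.
have [N0 NB] : (0 < N n)%N /\ (N n)%:R <= B * n%:R by near: n.
have N0' : 0 < (N n)%:R :> R by rewrite ltr0n.
have ne : B / (e ^+ 2 / 4) <= n%:R.
  by near: n; exact: nbhs_infty_ger.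
rewrite -ler_expR lnK ?posrE //.
apply: (le_trans NB).
have -> : e * n%:R = e * n%:R / 2 + e * n%:R / 2 by lra.
rewrite expRD.
have n0 : (0 : R) <= n%:R by [].
have en0 : 0 <= e * n%:R / 2 by rewrite divr_ge0 // mulr_ge0 // ltW.
have := expR_ge1Dx (e * n%:R / 2); set E := expR _ => hE.
have : (e * n%:R / 2) * (e * n%:R / 2) <= E * E.
  by apply: ler_pM => //; lra.
apply: le_trans.
have ee : 0 < e ^+ 2 / 4 by rewrite divr_gt0 // exprn_gt0.
rewrite ler_pdivrMr // in ne.
have -> : e * n%:R / 2 * (e * n%:R / 2) = n%:R * (e ^+ 2 / 4) * n%:R by field.
by rewrite ler_wpM2r.
Unshelve. all: by end_near. Qed.

Lemma near_pos_of_ratio (R : realType) (beta : R) (N : nat -> nat) :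
  0 < beta -> (n%:R / (N n)%:R : R) @[n --> \oo] --> beta ->
  \forall n \near \oo, (0 < N n)%N /\ (N n)%:R <= 2 / beta * n%:R.
Proof.
move=> b0 hb.
have b2 : beta / 2 < beta by lra.
near=> n.
have h : beta / 2 <= n%:R / (N n)%:R by near: n; exact: (cvgr_ge _ hb _ b2).
have Npos : (0 < N n)%N.
  (* If [N n = 0], the quotient is [0] by the convention on inverses, against [0 < beta / 2]. *)
  case: (N n) h => [|//]; rewrite invr0 mulr0 => h.
  by have := lt_le_trans (divr_gt0 b0 (@ltr0Sn R 1)) h; rewrite ltxx.
split=> //; rewrite ler_pdivlMr ?ltr0n // in h.
have -> : (N n)%:R = 2 / beta * (beta / 2 * (N n)%:R) :> R.
  by field; rewrite gt_eqF.
by rewrite ler_pM2l // divr_gt0.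
Unshelve. all: by end_near. Qed.

(** With [h = c / N], there are three errors of [e / 3]: the Riemann sum against the increment of
    [xlnx], the end point [s + k h] against its limit, and the prefactor [1 / (n h)] against
    [1 / (beta c)]. Only the first involves [ln s], which is at most [ln N] in absolute value; the
    others use the Lipschitz bound away from [0] and the boundedness of [xlnx]. *)
Lemma polya_log_uniform (R : realType) (c beta rho d : R) (N k : nat -> nat) :
  c != 0 -> 0 < beta -> 0 < d -> (forall n, k n <= n)%N ->
  (n%:R / (N n)%:R : R) @[n --> \oo] --> beta ->
  ((k n)%:R / n%:R : R) @[n --> \oo] --> rho ->
  forall e, 0 < e -> \forall n \near \oo, forall s,
    (N n)%:R^-1 <= s <= 1 -> d <= s + beta * c * rho ->
    `|n%:R^-1 * \sum_(l < k n) ln (s + l%:R * (c / (N n)%:R))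
      - (beta * c)^-1 * (xlnx (s + beta * c * rho) - xlnx s)| <= e.
Proof.
move=> c0 b0 d0 kn hb hk e e0.
have bc0 : beta * c != 0 by rewrite mulf_neq0 // gt_eqF.
have hx : ((k n)%:R * (c / (N n)%:R) : R) @[n --> \oo] --> beta * c * rho.
  have : ((k n)%:R / n%:R * (n%:R / (N n)%:R) * c : R) @[n --> \oo]
      --> rho * beta * c.
    by apply: cvgMr_tmp; exact: cvgM.
  have -> : rho * beta * c = beta * c * rho by ring.
  apply: cvg_trans; apply: near_eq_cvg; near=> n.
  have n0 : n%:R != 0 :> R by rewrite pnatr_eq0 -lt0n; near: n; exists 1%N.
  rewrite mulrA divfK // -mulrA [_^-1 * _]mulrC; ring.
have hi : ((n%:R / (N n)%:R * c)^-1 : R) @[n --> \oo] --> (beta * c)^-1.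
  by apply: cvgV => //; exact: cvgMr_tmp.
have hln := ln_natr_sublinear (near_pos_of_ratio b0 hb).
(* [B] bounds both end points once they are within [1] of each other, [K] is a Lipschitz constant of
   [xlnx] on [[d / 2, B]], [C] bounds [|xlnx|] on []0, B]], and [I] will bound [|1 / (n h)|]. *)
pose B := 2 + `|beta * c * rho|.
pose K := `|ln (d / 2)| + `|ln B|.
pose C := 1 + B * `|ln B|.
have B2 : 2 <= B by rewrite lerDl.
have K0 : 0 <= K by rewrite addr_ge0.
have C0 : 0 < C by rewrite ltr_pwDl // mulr_ge0 //; lra.
pose I := `|(beta * c)^-1| + 1.
have I0 : 0 < I by rewrite ltr_wpDl.
have e6 : 0 < e / 6 by rewrite divr_gt0.
have eIK : 0 < e / 3 / (I * (K + 1)).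
  by rewrite !divr_gt0 // mulr_gt0 // ltr_wpDl.
have m1 : 0 < Num.min (Num.min (d / 2) 1) (e / 3 / (I * (K + 1))).
  by rewrite !lt_min eIK ltr01 divr_gt0.
have m2 : 0 < Num.min 1 (e / 3 / (2 * C)).
  by rewrite lt_min ltr01 /= !divr_gt0 // mulr_gt0.
near=> n.
have [N0 _] : (0 < N n)%N /\ (N n)%:R <= 2 / beta * n%:R.
  by near: n; exact: near_pos_of_ratio.
have n0 : (0 < n)%N by near: n; exists 1%N.
have n0' : 0 < n%:R :> R by rewrite ltr0n.
have N0' : 0 < (N n)%:R :> R by rewrite ltr0n.
have lnN : ln ((N n)%:R) <= e / 6 * n%:R by near: n; exact: (hln _ e6).
have Kn : K <= e / 6 * n%:R.
  rewrite mulrC -ler_pdivrMr //; near: n; exact: nbhs_infty_ger.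
have xd : `|beta * c * rho - (k n)%:R * (c / (N n)%:R)| <=
    Num.min (Num.min (d / 2) 1) (e / 3 / (I * (K + 1))).
  by near: n; move/cvgrPdist_le: hx; apply.
have iI : `|(beta * c)^-1 - (n%:R / (N n)%:R * c)^-1| <=
    Num.min 1 (e / 3 / (2 * C)).
  by near: n; move/cvgrPdist_le: hi; apply.
move: xd iI; rewrite !le_min -!andbA => /and3P[xd1 xd2 xd3] /andP[iI1 iI2].
move=> s /andP[sN s1] ds.
set h := c / (N n)%:R in xd1 xd2 xd3 *.
set a := beta * c * rho in xd1 xd2 xd3 ds *.
have s0 : 0 < s by apply: lt_le_trans sN; rewrite invr_gt0.
have aB : s + a <= B.
  by rewrite /B -/a; have := ler_norm a; lra.
have [kl ku] : d / 2 <= s + (k n)%:R * h /\ s + (k n)%:R * h <= B.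
  move: xd1 xd2; rewrite !ler_norml => /andP[? ?] /andP[? ?].
  by rewrite /B -/a; have := ler_norm a; split; lra.
have pos l : (l <= k n)%N -> 0 < s + l%:R * h.
  move=> lk; have lk' : l%:R <= (k n)%:R :> R by rewrite ler_nat.
  have l0 : 0 <= l%:R :> R by [].
  have [h0|h0] := leP 0 h; first by rewrite ltr_pwDl // mulr_ge0.
  have : (k n)%:R * h <= l%:R * h by rewrite ler_wnM2r // ltW.
  lra.
have := sum_ln_xlnx pos.
set S := \sum_(l < _) _; set xk := s + _ in kl ku *.
have nh : n%:R * h = n%:R / (N n)%:R * c by rewrite /h; field; rewrite gt_eqF.
have h0 : h != 0 by rewrite mulf_neq0 // invr_eq0 gt_eqF.
rewrite normrM => T1.
have {}T1 : `|n%:R^-1 * S - (n%:R * h)^-1 * (xlnx xk - xlnx s)| <= e / 3.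
  have -> : n%:R^-1 * S - (n%:R * h)^-1 * (xlnx xk - xlnx s) =
      (n%:R * h)^-1 * (h * S - (xlnx xk - xlnx s)).
    by field; rewrite h0 gt_eqF.
  rewrite normrM normfV normrM (ger0_norm (ltW n0')).
  rewrite mulrC ler_pdivrMr; last by rewrite mulr_gt0 ?normr_gt0.
  apply: (le_trans T1).
  have -> : e / 3 * (n%:R * `|h|) = `|h| * (e / 3 * n%:R) by ring.
  rewrite ler_pM2l ?normr_gt0 //.
  have lxk : `|ln xk| <= K by apply: ler_norm_ln; [lra|rewrite kl ku].
  have lsN : `|ln s| <= ln ((N n)%:R).
    have : ln s <= 0 by exact: ln_le0.
    have : - ln (N n)%:R <= ln s.
      by rewrite -lnV ?posrE // ler_ln ?posrE // invr_gt0.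
    by move=> ? ?; rewrite ler_norml; apply/andP; split; lra.
  apply: (le_trans (ler_normB _ _)).
  lra.
have T2 : `|(n%:R * h)^-1 * (xlnx xk - xlnx s) -
            (n%:R * h)^-1 * (xlnx (s + a) - xlnx s)| <= e / 3.
  have -> : (n%:R * h)^-1 * (xlnx xk - xlnx s) -
      (n%:R * h)^-1 * (xlnx (s + a) - xlnx s) =
      (n%:R * h)^-1 * (xlnx xk - xlnx (s + a)) by ring.
  rewrite normrM nh.
  have nb : `|(n%:R / (N n)%:R * c)^-1| <= I.
    rewrite /I; set u := (beta * c)^-1 in iI1 *; set v := (_ / _ * c)^-1 in iI1 *.
    have := ler_normB u (u - v); have -> : u - (u - v) = v by ring.
    lra.
  have := @xlnx_lipschitz R (d / 2) B (s + a) xk.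
  rewrite kl ku aB; have -> : d / 2 <= s + a by lra.
  rewrite divr_gt0 // => /(_ isT isT isT) lip.
  have {}lip : `|xlnx xk - xlnx (s + a)| <= K * (e / 3 / (I * (K + 1))).
    apply: (le_trans lip); rewrite ler_wpM2l //.
    by rewrite /xk -[s + a]addrC -[s + _ *h]addrC opprD addrACA subrr addr0 distrC.
  apply: (@le_trans _ _ (I * (K * (e / 3 / (I * (K + 1)))))).
    by apply: ler_pM.
  have -> : I * (K * (e / 3 / (I * (K + 1)))) = e / 3 * (K / (K + 1)).
    by field; rewrite !gt_eqF // ltr_wpDl.
  rewrite ger_pMr ?divr_gt0 // ler_pdivrMr; lra.
have T3 : `|(n%:R * h)^-1 * (xlnx (s + a) - xlnx s) -
            (beta * c)^-1 * (xlnx (s + a) - xlnx s)| <= e / 3.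
  rewrite -mulrBl normrM nh distrC.
  have F1 : `|xlnx (s + a)| <= C by apply: xlnx_bounded; rewrite aB andbT; lra.
  have F2 : `|xlnx s| <= C by apply: xlnx_bounded; apply/andP; split; lra.
  apply: (@le_trans _ _ (e / 3 / (2 * C) * (2 * C))).
    apply: ler_pM => //; apply: (le_trans (ler_normB _ _)); lra.
  by rewrite divfK // gt_eqF // mulr_gt0.
move: T1 T2 T3; rewrite !ler_norml => /andP[? ?] /andP[? ?] /andP[? ?].
by apply/andP; split; lra.
Unshelve. all: by end_near. Qed.

(** * Concentration of the color frequencies *)

(** Inverting [1 - y <= expR (- y)] gives [expR y <= 1 / (1 - y)], and [(1 + y + 2 y ^ 2) (1 - y) =
    1 + y ^ 2 (1 - 2 y)] is at least [1]. *)
Lemma expR_le1DxDsqr (R : realType) (y : R) :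
  `|y| <= 2^-1 -> expR y <= 1 + y + 2 * y ^+ 2.
Proof.
rewrite ler_norml => /andP[y1 y2].
have y0 : 0 < 1 - y by lra.
have := expR_ge1Dx (- y); rewrite expRN.
rewrite -ler_pV2 ?inE ?unitfE ?invr_eq0 ?gt_eqF ?invr_gt0 ?expR_gt0 // invrK.
move/le_trans; apply; rewrite -[_^-1]mul1r ler_pdivrMr //.
have : 0 <= y ^+ 2 by rewrite sqr_ge0.
by rewrite expr2; nra.
Qed.

Lemma big_cons_tuple (V : nmodType) (T : finType) (n : nat)
    (F : n.+1.-tuple T -> V) :
  \sum_(x : n.+1.-tuple T) F x =
  \sum_(x : n.-tuple T) \sum_(i : T) F [tuple of i :: x].
Proof.
rewrite pair_big /= (reindex (fun p : n.-tuple T * T => [tuple of p.2 :: p.1])) //.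
exists (fun x : n.+1.-tuple T =>
  ([tuple of behead x] : n.-tuple T, thead x)) => [[x i] _|x _] /=.
  by congr pair; apply: val_inj.
by rewrite -tuple_eta.
Qed.

Lemma sum_count_mem (T : finType) (s : seq T) :
  (\sum_(i : T) count_mem i s = size s)%N.
Proof.
elim: s => [|a s IH]; first by rewrite big1.
rewrite /= big_split /= IH (bigD1 a) //= eqxx big1 // => i.
by rewrite eq_sym => /negbTE ->.
Qed.

(** The head of the tuple acts as the latest draw; the added factor is the proportion of color [i]
    in the urn after the draws [x]. *)
Lemma polya_prob_cons (R : realType) (m : nat) (c : int) (n M : nat)
    (q : 'rV[R]_m) (x : n.-tuple 'I_m) (i : 'I_m) :
  polya_prob c M q [tuple of i :: x] = polya_prob c M q x *
   ((M%:R * q 0 i + (count_mem i x)%:R * c%:~R) / (M%:R + n%:R * c%:~R)).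
Proof.
rewrite /polya_prob big_ord_recr /= invfM.
rewrite (bigD1 i) //= [in RHS](bigD1 i) //= eqxx add1n big_ord_recr /=.
rewrite (eq_bigr (fun j => \prod_(l < count_mem j x)
    (M%:R * q 0 j + l%:R * c%:~R))); last first.
  by move=> j ji; rewrite eq_sym (negbTE ji) add0n.
ring.
Qed.

Lemma polya_prob_ge0 (R : realType) (m : nat) (c : int) (n M : nat)
    (q : 'rV[R]_m) (x : n.-tuple 'I_m) :
  (forall j l, (l < n)%N -> 0 <= M%:R * q 0 j + l%:R * c%:~R) ->
  (forall l, (l < n)%N -> 0 <= M%:R + l%:R * c%:~R :> R) ->
  0 <= polya_prob c M q x.
Proof.
move=> hq hM; apply: divr_ge0.
  apply: prodr_ge0 => i _; apply: prodr_ge0 => l _; apply: hq.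
  by apply: (leq_trans (ltn_ord l)); rewrite -[X in (_ <= X)%N](size_tuple x) count_size.
by apply: prodr_ge0 => l _; apply: hM.
Qed.

(* [(count_mem i x - n q_i) / (M + n c)] is a martingale along the draws. *)
Lemma polya_mgf (R : realType) (m : nat) (c : int) (M : nat)
    (q : 'rV[R]_m) (b t : R) (i : 'I_m) (n : nat) :
  0 < b -> \sum_j q 0 j = 1 ->
  (forall j l, (l < n)%N -> 0 <= M%:R * q 0 j + l%:R * c%:~R) ->
  (forall l, (l <= n)%N -> b <= M%:R + l%:R * c%:~R) ->
  `|t| <= b / 2 ->
  \sum_(x : n.-tuple 'I_m) polya_prob c M q x *
    expR (t * (((count_mem i x)%:R - n%:R * q 0 i) / (M%:R + n%:R * c%:~R)))
  <= expR (n%:R * (2 * (t / b) ^+ 2)).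
Proof.
move=> b0 q1; elim: n => [|n IH] hq hb tb.
  have t0 : xpredT =1 pred1 (nil_tuple 'I_m).
    by move=> x /=; apply/esym/eqP; exact: tuple0.
  rewrite (big_pred1 _ t0).
  rewrite /polya_prob /= !big1 ?mul0r ?subrr ?mul0r ?mulr0 //; last first.
  - by move=> j _; rewrite big_ord0.
  - by case.
  by rewrite invr1 !mulr1 expR0.
have {}IH := IH (fun j l ln => hq j l (ltnW ln)) (fun l ln => hb l (leqW ln)) tb.
have bn : 0 < M%:R + n%:R * c%:~R :> R by exact: lt_le_trans (hb _ (leqnSn _)).
have bn1 : 0 < M%:R + n.+1%:R * c%:~R :> R by exact: lt_le_trans (hb _ (leqnn _)).
rewrite big_cons_tuple.
have -> : n.+1%:R * (2 * (t / b) ^+ 2) = n%:R * (2 * (t / b) ^+ 2) + 2 * (t / b) ^+ 2.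
  by rewrite -natr1; ring.
rewrite expRD.
apply: (le_trans _ (ler_wpM2r (expR_ge0 _) IH)).
rewrite mulr_suml; apply: ler_sum => x _.
have px0 : 0 <= polya_prob c M q x.
  apply: polya_prob_ge0 => [j l ln|l ln]; first exact: hq (ltnW ln).
  by apply: (le_trans (ltW b0)); exact: hb (leqW (ltnW ln)).
(* [p] is the law of the next color given [x], [Y] the current value of the martingale scaled by
   [t], and [y j] the increment of [Y] if the next color is [j]. *)
pose p j := (M%:R * q 0 j + (count_mem j x)%:R * c%:~R) / (M%:R + n%:R * c%:~R).
have cx j : (count_mem j x < n.+1)%N.
  by rewrite ltnS -[X in (_ <= X)%N](size_tuple x) count_size.
have p0 j : 0 <= p j by rewrite divr_ge0 ?(ltW bn) // hq.
have p1 : \sum_j p j = 1.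
  rewrite -mulr_suml big_split /= -mulr_sumr q1 -mulr_suml -natr_sum sum_count_mem.
  by rewrite size_tuple mulr1 divff // gt_eqF.
pose y j := t * (((j == i)%:R - p i) / (M%:R + n.+1%:R * c%:~R)).
pose Y := t * (((count_mem i x)%:R - n%:R * q 0 i) / (M%:R + n%:R * c%:~R)).
have step j : polya_prob c M q [tuple of j :: x] *
    expR (t * (((count_mem i [tuple of j :: x])%:R - n.+1%:R * q 0 i)
       / (M%:R + n.+1%:R * c%:~R))) =
    polya_prob c M q x * expR Y * (p j * expR (y j)).
  rewrite polya_prob_cons -/(p j) [RHS]mulrACA -expRD; congr (_ * expR _).
  rewrite /Y /y /p /= natrD.
  move: (gt_eqF bn1) (gt_eqF bn) => /negbT d1 /negbT d0.
  have E : M%:R + n.+1%:R * c%:~R = M%:R + n%:R * c%:~R + c%:~R :> R.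
    by rewrite -natr1; ring.
  rewrite E -natr1 in d1 *; move: d1 d0; set D := M%:R + n%:R * c%:~R => d1 d0.
  have -> : (M%:R * q 0 i + (count_mem i x)%:R * c%:~R) / D =
      ((D - n%:R * c%:~R) * q 0 i + (count_mem i x)%:R * c%:~R) / D.
    by rewrite /D addrK.
  by field; rewrite d0 d1.
under eq_bigr => j _ do rewrite step.
rewrite -mulr_sumr; apply: ler_wpM2l; first exact: mulr_ge0 px0 (expR_ge0 _).
have ple1 : p i <= 1.
  by rewrite -p1 (bigD1 i) //= lerDl sumr_ge0.
have yb j : `|y j| <= `|t| / b.
  rewrite /y normrM ler_wpM2l // normrM normfV (gtr0_norm bn1).
  rewrite ler_pdivrMr // mulrC -ler_pdivrMr ?invr_gt0 // invrK.
  apply: (@le_trans _ _ b); last exact: hb.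
  rewrite ger_pMl // ler_norml; have := p0 i.
  by case: (j == i) => /=; rewrite ?mulr1n ?mulr0n => *; apply/andP; split; lra.
have tb2 : `|t| / b <= 2^-1 by rewrite ler_pdivrMr // mulrC.
have y2 j : y j ^+ 2 <= (t / b) ^+ 2.
  rewrite -[(t / b) ^+ 2]real_normK ?num_real // -[y j ^+ 2]real_normK ?num_real //.
  by rewrite lerXn2r ?nnegrE // [`|t / b|]normrM normfV (gtr0_norm b0).
(* Under [p] the increment is centered, so the linear term of the expansion vanishes and only the
   quadratic one remains to be bounded. *)
apply: le_trans (expR_ge1Dx _).
apply: (@le_trans _ _ (\sum_j (p j + p j * y j + p j * (2 * (t / b) ^+ 2)))).
  apply: ler_sum => j _.
  have := expR_le1DxDsqr (le_trans (yb j) tb2) => h.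
  have -> : p j + p j * y j + p j * (2 * (t / b) ^+ 2) =
     p j * (1 + y j + 2 * (t / b) ^+ 2) by ring.
  by rewrite ler_wpM2l // (le_trans h) // lerD2l ler_pM2l.
rewrite !big_split /= p1 -mulr_suml p1 mul1r.
suff -> : \sum_j p j * y j = 0 by rewrite addr0.
rewrite (eq_bigr (fun j => (t / (M%:R + n.+1%:R * c%:~R)) *
   (p j * (j == i)%:R) - (t / (M%:R + n.+1%:R * c%:~R)) * p i * p j)); last first.
  by move=> j _; rewrite /y; ring.
rewrite sumrB -!mulr_sumr p1 (bigD1 i) //= eqxx big1 => [|j /negbTE ->].
  by rewrite mulr1 addr0 mulr1 subrr.
by rewrite mulr0.
Qed.

Lemma ae_near_not_of_geometric (R : realType) (d : measure_display)
    (Omega : measurableType d) (P : probability Omega R)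
    (E : nat -> set Omega) (eta K : R) :
  0 < eta -> 0 <= K ->
  (\forall n \near \oo, measurable (E n) /\
     (P (E n) <= (K * expR (- eta) ^+ n)%:E)%E) ->
  {ae P, forall w, \forall n \near \oo, ~ E n w}.
Proof.
move=> eta0 K0 [n0 _ hE].
(* The hypotheses hold only from [n0] on; emptying the earlier sets keeps the limit superior and
   makes measurability and the bound hold for every index. *)
pose F n := if (n0 <= n)%N then E n else set0.
have mF n : measurable (F n).
  by rewrite /F; case: ifP => // h; have [] := hE n h.
have PF n : (P (F n) <= (geometric K (expR (- eta)) n)%:E)%E.
  rewrite /F /=; case: ifP => h; first by have [_] := hE n h.
  by rewrite measure0 lee_fin mulr_ge0 // exprn_ge0 // expR_ge0.
have z1 : `|expR (- eta)| < 1.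
  by rewrite ger0_norm ?expR_ge0 // expR_lt1 oppr_lt0.
have : P (lim_sup_set F) = 0.
  apply: lim_sup_set_cvg0 => //.
  apply: (@le_lt_trans _ _ (\sum_(n <oo) (geometric K (expR (- eta)) n)%:E)%E).
    by apply: lee_nneseries => n *; [exact: measure_ge0 | exact: PF].
  have -> : (\sum_(n <oo) (geometric K (expR (- eta)) n)%:E)%E =
      (limn (series (geometric K (expR (- eta)))))%:E.
    rewrite -EFin_lim; last exact: is_cvg_geometric_series.
    by congr (limn _); apply/funext => n; rewrite /= sumEFin.
  exact: ltry.
have mL : measurable (lim_sup_set F).
  by apply: bigcap_measurable => // k _; exact: bigcup_measurable.
move=> P0; exists (lim_sup_set F); split => // w /= nw n _.
apply: contrapT => /= h; apply: nw; exists (maxn n n0) => // k /=.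
rewrite geq_max => /andP[nk n0k] Ekw; apply: h; exists k => //=.
by rewrite /F n0k.
Qed.

(** Chernoff bound with [t = kap n] and [t = - kap n]: on the event, the martingale is at least
    [e / U] in absolute value. [eta] depends on [U] and [e] only, so the urn may vary with [n]. *)
Lemma polya_tail (R : realType) (m : nat) (c : int) (U e : R) :
  0 < U -> 0 < e -> exists2 eta : R, 0 < eta &
  forall (n M : nat) (q : 'rV[R]_m) (i : 'I_m), (0 < n)%N ->
    \sum_j q 0 j = 1 ->
    (forall j l, (l < n)%N -> 0 <= M%:R * q 0 j + l%:R * c%:~R) ->
    (forall l, (l <= n)%N -> n%:R <= M%:R + l%:R * c%:~R :> R) ->
    M%:R + n%:R * c%:~R <= U * n%:R ->
    \sum_(x : n.-tuple 'I_m |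
          e * n%:R <= `|(count_mem i x)%:R - n%:R * q 0 i|)
      polya_prob c M q x <= 2 * expR (- eta) ^+ n.
Proof.
move=> U0 e0.
(* [kap <= 1 / 2] meets the constraint on [t] in [polya_mgf] for [b = n]; [kap <= e / (4 U)] makes
   the cost [2 kap ^ 2] at most half of the gain [kap e / U], and [eta] is the other half. *)
pose kap := Num.min 2^-1 (e / (4 * U)).
have kap0 : 0 < kap by rewrite lt_min invr_gt0 ltr0n divr_gt0 // mulr_gt0.
have [kap1 kap2] : kap <= 2^-1 /\ kap <= e / (4 * U).
  by split; rewrite /kap ge_min lexx ?orbT.
exists (kap * (e / (2 * U))); first by rewrite mulr_gt0 // divr_gt0 // mulr_gt0.
move=> n M q i n0 q1 hq hn hU.
have n0' : 0 < n%:R :> R by rewrite ltr0n.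
pose b : R := n%:R.
pose Y (x : n.-tuple 'I_m) :=
  ((count_mem i x)%:R - n%:R * q 0 i) / (M%:R + n%:R * c%:~R).
have D0 : 0 < M%:R + n%:R * c%:~R :> R by exact: lt_le_trans (hn _ (leqnn _)).
have px0 (x : n.-tuple 'I_m) : 0 <= polya_prob c M q x.
  apply: polya_prob_ge0 => [j l ln|l ln]; first exact: hq.
  by apply: le_trans (hn _ (ltnW ln)).
have mgf (t : R) : `|t| = kap * n%:R ->
   \sum_(x : n.-tuple 'I_m) polya_prob c M q x * expR (t * Y x)
    <= expR (n%:R * (2 * kap ^+ 2)).
  move=> ht.
  have tb : `|t| <= b / 2 by rewrite ht mulrC ler_pM2l.
  apply: (le_trans (polya_mgf i n0' q1 hq hn tb)).
  rewrite ler_expR ler_pM2l // ler_pM2l // -real_normK ?num_real //.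
  by rewrite normrM ht normfV (gtr0_norm n0') mulfK // gt_eqF.
have hp := mgf (kap * n%:R); have hm := mgf (- (kap * n%:R)).
rewrite ger0_norm in hp; last by rewrite mulr_ge0 // ltW.
rewrite normrN ger0_norm in hm; last by rewrite mulr_ge0 // ltW.
have {}hp := hp erefl; have {}hm := hm erefl.
pose T := kap * n%:R * (e / U).
have main : \sum_(x : n.-tuple 'I_m |
        e * n%:R <= `|(count_mem i x)%:R - n%:R * q 0 i|)
      polya_prob c M q x * expR T <=
   \sum_(x : n.-tuple 'I_m) polya_prob c M q x * expR (kap * n%:R * Y x) +
   \sum_(x : n.-tuple 'I_m) polya_prob c M q x * expR (- (kap * n%:R) * Y x).
  rewrite -big_split big_mkcond /=; apply: ler_sum => x _.
  case: ifP => [hx|_]; last by rewrite addr_ge0 // mulr_ge0 // expR_ge0.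
  rewrite -mulrDr ler_wpM2l //.
  have hY : e / U <= `|Y x|.
    rewrite normrM normfV (gtr0_norm D0) ler_pdivlMr // mulrAC ler_pdivrMr //.
    apply: (@le_trans _ _ (e * n%:R * U)); last by rewrite ler_wpM2r // ltW.
    by rewrite -mulrA [n%:R * U]mulrC ler_wpM2l // ltW.
  have [Y0|Y0] := leP 0 (Y x).
    rewrite ger0_norm // in hY.
    apply: (@le_trans _ _ (expR (kap * n%:R * Y x))).
      by rewrite ler_expR ler_wpM2l // mulr_ge0 // ltW.
    by rewrite lerDl expR_ge0.
  rewrite ltr0_norm // in hY.
  apply: (@le_trans _ _ (expR (- (kap * n%:R) * Y x))).
    by rewrite ler_expR mulNr -mulrN ler_wpM2l // mulr_ge0 // ltW.
  by rewrite lerDr expR_ge0.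
have {main hp hm} := le_trans main (lerD hp hm).
rewrite -mulr_suml -mulr2n -[_ *+ 2]mulr_natl -ler_pdivlMr ?expR_gt0 //.
move/le_trans; apply.
rewrite -[leLHS]mulrA ler_pM2l // -expRB -expRM_natl ler_expR /T.
rewrite mulrN.
have -> : n%:R * (2 * kap ^+ 2) - kap * n%:R * (e / U) =
   n%:R * kap * (2 * kap - e / U) by ring.
have -> : - (n%:R * (kap * (e / (2 * U)))) = n%:R * kap * (- (e / (2 * U))) by ring.
rewrite ler_pM2l ?mulr_gt0 //.
have -> : e / U = 4 * (e / (4 * U)) by field; rewrite gt_eqF.
have -> : e / (2 * U) = 2 * (e / (4 * U)) by field; rewrite gt_eqF.
lra.
Qed.

(** Each tolerance and color has its own null set; restricting the tolerances to [1 / (k + 1)]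
    leaves countably many of them, whose union is a single null set. *)
Lemma polya_frequency_ae (R : realType) (m : nat) (d : measure_display)
    (Omega : measurableType d) (P : probability Omega R) (c : int)
    (N : nat -> nat) (r_ : nat -> 'rV[R]_m)
    (X : forall n : nat, Omega -> n.-tuple 'I_m) (U : R) :
  polya_samples P c N r_ X ->
  (forall n, (0 < n)%N -> \sum_j r_ (N n) 0 j = 1) ->
  (forall n, (0 < n)%N -> forall j l, (l < n)%N ->
     0 <= (N n)%:R * r_ (N n) 0 j + l%:R * c%:~R) ->
  (\forall n \near \oo, (forall l, (l <= n)%N ->
      n%:R <= (N n)%:R + l%:R * c%:~R :> R) /\
    (N n)%:R + n%:R * c%:~R <= U * n%:R) ->
  {ae P, forall w, forall e : R, 0 < e -> forall i, \forall n \near \oo,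
     `|(count_mem i (X n w))%:R / n%:R - r_ (N n) 0 i| <= e}.
Proof.
move=> hX hr1 hpos hN.
have {}hN : \forall n \near \oo, (forall l, (l <= n)%N ->
      n%:R <= (N n)%:R + l%:R * c%:~R :> R) /\
    (N n)%:R + n%:R * c%:~R <= (`|U| + 1) * n%:R.
  near=> n; have [] : (forall l, (l <= n)%N ->
      n%:R <= (N n)%:R + l%:R * c%:~R :> R) /\
    (N n)%:R + n%:R * c%:~R <= U * n%:R by near: n.
  split=> //; apply: (le_trans b); rewrite ler_wpM2r //.
  by have := ler_norm U; lra.
have U0 : 0 < `|U| + 1 :> R by rewrite ltr_wpDl.
have key (e : R) i : 0 < e -> {ae P, forall w, \forall n \near \oo,
    ~ (e * n%:R <= `|(count_mem i (X n w))%:R - n%:R * r_ (N n) 0 i|)}.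
  move=> e0; have [eta eta0 tail] := @polya_tail R m c _ _ U0 e0.
  apply: (@ae_near_not_of_geometric _ _ _ P
    (fun n => [set w | e * n%:R <=
      `|(count_mem i (X n w))%:R - n%:R * r_ (N n) 0 i|]) eta 2) => //.
  near=> n.
  have n0 : (0 < n)%N by near: n; exists 1%N.
  have [h1 h2] : (forall l, (l <= n)%N ->
      n%:R <= (N n)%:R + l%:R * c%:~R :> R) /\
    (N n)%:R + n%:R * c%:~R <= (`|U| + 1) * n%:R by near: n.
  pose A := [set x : n.-tuple 'I_m | e * n%:R <=
      `|(count_mem i x)%:R - n%:R * r_ (N n) 0 i|].
  have fA : finite_set A by exact: finite_finset.
  (* The event is a finite union of fibers of [X n], so it is measurable and its probability is
     bounded through the law of row [n] alone. *)
  have -> : [set w | e * n%:R <=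
      `|(count_mem i (X n w))%:R - n%:R * r_ (N n) 0 i|] =
      \bigcup_(x in A) (X n @^-1` [set x]).
    by apply/seteqP; split=> [w h|w [x Ax] /= h]; [exists (X n w)|rewrite h].
  have mA : measurable (\bigcup_(x in A) (X n @^-1` [set x])).
    by apply: fin_bigcup_measurable => // x _; have [] := hX n n0 x.
  split=> //.
  apply: (@le_trans _ _ (\sum_(x \in A) P (X n @^-1` [set x]))%E).
    by apply: content_sub_fsum => // x _; have [] := hX n n0 x.
  have := tail n (N n) (r_ (N n)) i n0 (hr1 n n0) (hpos n n0) h1 h2.
  rewrite -lee_fin; apply: le_trans.
  rewrite (eq_fsbigr (fun x => (polya_prob c (N n) (r_ (N n)) x)%:E)); last first.
    by move=> x _; have [] := hX n n0 x.
  rewrite -sumEFin -big_enum /= [leRHS]fsbig_seq ?enum_uniq //.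
  suff -> : [set` enum (fun x : n.-tuple 'I_m => e * n%:R <=
      `|(count_mem i x)%:R - n%:R * r_ (N n) 0 i|)] = A by [].
  by apply/seteqP; split=> x; rewrite /= mem_enum.
have : {ae P, forall w, forall k : nat, forall i, \forall n \near \oo,
    ~ (k.+1%:R^-1 * n%:R <= `|(count_mem i (X n w))%:R - n%:R * r_ (N n) 0 i|)}.
  apply: ae_foralln => k; apply: filter_forall => i.
  by apply: key; rewrite invr_gt0.
apply: filterS => w hw e e0 i.
have [k _ hk] : \forall k \near \oo, e^-1 <= k%:R by exact: nbhs_infty_ger.
have {}hk : k.+1%:R^-1 <= e.
  rewrite -[e]invrK lef_pV2 ?posrE ?invr_gt0 //.
  by apply: hk => /=.
near=> n.
have n0 : (0 < n)%N by near: n; exists 1%N.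
have n0' : 0 < n%:R :> R by rewrite ltr0n.
have : ~ (k.+1%:R^-1 * n%:R <= `|(count_mem i (X n w))%:R - n%:R * r_ (N n) 0 i|).
  by near: n; exact: hw.
move/negP; rewrite -ltNge => /ltW h.
rewrite -(ler_pM2r n0') -{2}(gtr0_norm n0') -normrM mulrBl divfK ?gt_eqF //.
rewrite [r_ _ _ _ * _]mulrC; apply: (le_trans h).
by rewrite ler_pM2r.
Unshelve. all: by end_near. Qed.

(** * The Laplace principle and the log-likelihood *)

Lemma ler_fsum (R : numDomainType) (T : choiceType) (D : set T) (f g : T -> R) :
  finite_set D -> (forall x, D x -> f x <= g x) ->
  \sum_(x \in D) f x <= \sum_(x \in D) g x.
Proof.
move=> fD fg; rewrite !fsbig_finite // big_seq_cond [leRHS]big_seq_cond.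
apply: ler_sum => x /andP[+ _]; rewrite in_fset_set // inE; exact: fg.
Qed.

Lemma ler_fsum_nneg_subset (R : numDomainType) (T : choiceType) (D E : set T)
    (f : T -> R) :
  finite_set E -> D `<=` E -> (forall x, E x -> 0 <= f x) ->
  \sum_(x \in D) f x <= \sum_(x \in E) f x.
Proof.
move=> fE DE f0; rewrite -(setIidr DE) fsbig_mkcondr; apply: ler_fsum => // x Ex.
by case: ifP => // _; exact: f0.
Qed.

(** Above, the total weight is at most [1], so [S] is at most the largest exponential; below, [S] is
    restricted to [U], where [g n] nearly reaches [h] and the weight costs little in the exponent.
    Positivity of [S] belongs to the conclusion because [ln] has a default value elsewhere. *)
Lemma laplace_principle (R : realType) (T : choiceType) (A : set T)
    (D : nat -> set T) (w g : nat -> T -> R) (h : R) :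
  (\forall n \near \oo, [/\ finite_set (D n), forall q, D n q -> 0 <= w n q
     & \sum_(q \in D n) w n q <= 1]) ->
  (forall e : R, 0 < e -> \forall n \near \oo, forall q,
     (A `&` D n) q -> g n q <= h + e) ->
  (forall e : R, 0 < e -> exists U : set T, \forall n \near \oo,
     (forall q, (U `&` D n) q -> A q /\ h - e <= g n q) /\
     expR (- (e * n%:R)) <= \sum_(q \in U `&` D n) w n q) ->
  forall e : R, 0 < e -> \forall n \near \oo,
    let S := \sum_(q \in A `&` D n) (w n q * expR (n%:R * g n q)) in
    0 < S /\ `|n%:R^-1 * ln S - h| <= e.
Proof.
move=> hw up low e e0.
have e2 : 0 < e / 2 by rewrite divr_gt0.
have [U hU] := low _ e2.
near=> n => /=.
have n0 : (0 < n)%N by near: n; exists 1%N.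
have n0' : 0 < n%:R :> R by rewrite ltr0n.
have [fD w0 w1] : [/\ finite_set (D n), forall q, D n q -> 0 <= w n q
     & \sum_(q \in D n) w n q <= 1] by near: n.
have hup : forall q, (A `&` D n) q -> g n q <= h + e by near: n; exact: up.
have [hlow hmass] : (forall q, (U `&` D n) q -> A q /\ h - e / 2 <= g n q) /\
     expR (- (e / 2 * n%:R)) <= \sum_(q \in U `&` D n) w n q by near: n.
set S := \sum_(q \in _) _.
have fA : finite_set (A `&` D n) by exact: finite_setIr.
have fU : finite_set (U `&` D n) by exact: finite_setIr.
have t0 q : D n q -> 0 <= w n q * expR (n%:R * g n q).
  by move=> Dq; rewrite mulr_ge0 ?expR_ge0 // w0.
have hi : S <= expR (n%:R * (h + e)).
  apply: (@le_trans _ _ (\sum_(q \in A `&` D n) (w n q * expR (n%:R * (h + e))))).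
    apply: ler_fsum => // q Aq; rewrite ler_wpM2l ?ler_expR ?ler_pM2l //.
    - by apply: w0; case: Aq.
    - exact: hup.
  rewrite -mulr_fsuml ger_pMl ?expR_gt0 //.
  by apply: le_trans w1; apply: ler_fsum_nneg_subset => // ? [].
have lo : expR (n%:R * (h - e)) <= S.
  apply: (@le_trans _ _ (\sum_(q \in U `&` D n) (w n q * expR (n%:R * g n q)))).
    apply: (@le_trans _ _
      (\sum_(q \in U `&` D n) (w n q * expR (n%:R * (h - e / 2))))).
      rewrite -mulr_fsuml.
      have -> : n%:R * (h - e) = - (e / 2 * n%:R) + n%:R * (h - e / 2) by field.
      by rewrite expRD ler_wpM2r ?expR_ge0.
    apply: ler_fsum => // q [Uq Dq]; rewrite ler_wpM2l ?w0 //.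
    rewrite ler_expR ler_pM2l //.
    by have [] := hlow q (conj Uq Dq).
  apply: ler_fsum_nneg_subset => //; last by move=> q [_]; exact: t0.
  by move=> q [Uq Dq]; split=> //; have [] := hlow q (conj Uq Dq).
have S0 : 0 < S by apply: lt_le_trans lo; exact: expR_gt0.
split=> //.
have l1 : ln S <= n%:R * (h + e) by rewrite -[leRHS]expRK ler_ln ?posrE ?expR_gt0.
have l2 : n%:R * (h - e) <= ln S by rewrite -[leLHS]expRK ler_ln ?posrE ?expR_gt0.
have : h - e <= n%:R^-1 * ln S by rewrite mulrC ler_pdivlMr // mulrC.
have : n%:R^-1 * ln S <= h + e by rewrite mulrC ler_pdivrMr // mulrC.
by move=> *; rewrite ler_norml; apply/andP; split; lra.
Unshelve. all: by end_near. Qed.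

Lemma finite_urn_config (R : realType) (m M : nat) : finite_set (@urn_config R m M).
Proof.
apply: (@sub_finite_set _ _ ((fun f : {ffun 'I_m -> 'I_M.+1} =>
    \row_i ((f i)%:R / M%:R)) @` setT)).
  move=> q [_ [alpha [sa ->]]] /=.
  have le_a i : (alpha i < M.+1)%N by rewrite ltnS -sa (bigD1 i) //= leq_addr.
  exists [ffun i => Ordinal (le_a i)] => //.
  by apply/rowP => i; rewrite !mxE ffunE.
by apply: finite_image; exact: finite_finset.
Qed.

(** The origin of the cutoff [1 / N] in [polya_log_uniform]: a color that is present has at least
    one ball. *)
Lemma urn_config_entry (R : realType) (m M : nat) (q : 'rV[R]_m) i :
  urn_config M q -> 0 < q 0 i -> M%:R^-1 <= q 0 i.
Proof.
move=> [M0 [alpha [_ ->]]]; rewrite mxE; case: (alpha i) => [|a].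
  by rewrite mul0r ltxx.
move=> _; rewrite -[leLHS]mul1r ler_pM2r ?invr_gt0 ?ltr0n //.
by rewrite ler1n.
Qed.

Lemma urn_config_sum (R : realType) (m M : nat) (q : 'rV[R]_m) :
  urn_config M q -> \sum_i q 0 i = 1.
Proof.
move=> [M0 [alpha [sa ->]]].
rewrite (eq_bigr (fun i => (alpha i)%:R / M%:R)); last by move=> i _; rewrite mxE.
by rewrite -mulr_suml -natr_sum sa divff // pnatr_eq0 -lt0n.
Qed.

Lemma pmf_entry_le1 (R : realType) (m : nat) (q : 'rV[R]_m) i :
  (forall j, 0 <= q 0 j) -> \sum_j q 0 j = 1 -> q 0 i <= 1.
Proof. by move=> q0 <-; rewrite (bigD1 i) //= lerDl sumr_ge0. Qed.

Lemma urn_config_ge0 (R : realType) (m M : nat) (q : 'rV[R]_m) i :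
  urn_config M q -> 0 <= q 0 i.
Proof. by move=> [M0 [alpha [_ ->]]]; rewrite mxE divr_ge0. Qed.

(** Ball counts are divided by [M], so that entries of [q] appear directly. The counts [k] are
    arbitrary, which makes the convergence statements below deterministic. *)
Definition urn_loglik (R : realType) (m : nat) (c : int) (n M : nat)
    (k : 'I_m -> nat) (q : 'rV[R]_m) : R :=
  \sum_i n%:R^-1 * \sum_(l < k i) ln (q 0 i + l%:R * (c%:~R / M%:R)).

(** The counts sum to [n], so [M ^ n] splits into one factor [M] for each term of the products. The
    prefactor is free of [q] and cancels in the posterior. *)
Lemma polya_prob_loglik (R : realType) (m : nat) (c : int) (n M : nat)
    (q : 'rV[R]_m) (x : n.-tuple 'I_m) : (0 < n)%N -> (0 < M)%N ->
  (forall i l, (l < count_mem i x)%N -> 0 < M%:R * q 0 i + l%:R * c%:~R) ->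
  polya_prob c M q x =
    (M%:R ^+ n / \prod_(l < n) (M%:R + l%:R * c%:~R)) *
    expR (n%:R * urn_loglik c n M (fun i => count_mem i x) q).
Proof.
move=> n0 M0 pos; rewrite /polya_prob mulrAC; congr (_ / _).
have M0' : 0 < M%:R :> R by rewrite ltr0n.
rewrite /urn_loglik -mulr_sumr mulrA divff ?pnatr_eq0 -?lt0n // mul1r.
rewrite expR_sum -[X in _ ^+ X](size_tuple x) -sum_count_mem -prodrXr.
rewrite -big_split /=.
apply: eq_bigr => i _; rewrite expR_sum -[X in _ ^+ X]card_ord -prodr_const.
rewrite -big_split /=; apply: eq_bigr => l _.
rewrite lnK ?posrE.
  by field; rewrite gt_eqF.
have -> : q 0 i + l%:R * (c%:~R / M%:R) =
    (M%:R * q 0 i + l%:R * c%:~R) / M%:R by field; rewrite gt_eqF.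
by rewrite divr_gt0 // pos.
Qed.

(** * Convergence to the divergence *)

(** The right-hand side is the sum over [i] of the integrals of [ln (q_i + beta c t)] over
    [[0, p_i]]; the linear part of [xlnx] contributes minus the sum of the [p_i], whence the
    constant [1]. *)
Lemma polya_L_xlnx (R : realType) (m : nat) (c : int) (beta : R)
    (q p : 'rV[R]_m) : c != 0 -> beta != 0 -> \sum_i p 0 i = 1 ->
  (forall i, 0 < q 0 i) -> (forall i, 0 < q 0 i + beta * c%:~R * p 0 i) ->
  - polya_L c beta q p - 1 = \sum_i (beta * c%:~R)^-1 *
    (xlnx (q 0 i + beta * c%:~R * p 0 i) - xlnx (q 0 i)).
Proof.
move=> c0 b0 p1 q0 qp0; rewrite /polya_L (negbTE c0).
have a0 : beta * c%:~R != 0 :> R by rewrite mulf_neq0 // intr_eq0.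
set a := beta * c%:~R in qp0 a0 *.
rewrite mulr_sumr -sumrN -p1 -big_split /= -!sumrN -big_split /=.
apply: eq_bigr => i _; rewrite ln_div ?posrE // /xlnx.
by set u := ln (_ + _); set v := ln (q 0 i); field.
Qed.

Lemma polya_L0 (R : realType) (m : nat) (beta : R) (q p : 'rV[R]_m) :
  - polya_L 0 beta q p - 1 = \sum_i p 0 i * ln (q 0 i).
Proof. by rewrite /polya_L eqxx; ring. Qed.

Lemma full_pmf_lt1 (R : realType) (m : nat) (p : 'rV[R]_m) i :
  (1 < m)%N -> full_pmf p -> p 0 i < 1.
Proof.
move=> m1 [p0 p1].
have [j ji] : exists j : 'I_m, j != i.
  have /card_gt1P[a [b [_ _ ab]]] : (1 < #|'I_m|)%N by rewrite card_ord.
  have [<-|ai] := eqVneq a i; first by exists b; rewrite eq_sym.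
  by exists a.
rewrite -p1 (bigD1 i) //= (bigD1 j) //= ltrDl ltr_pwDl // sumr_ge0 // => l _.
exact: ltW.
Qed.

Lemma intr_leN1 (R : realType) (c : int) : c < 0 -> c%:~R <= -1 :> R.
Proof.
move=> c0; rewrite -[-1]/((-1)%:~R) ler_int; move: c0.
by rewrite -ltzD1 addNr.
Qed.

(* For [c < 0] admissibility bounds [q_i] below by [(n / N) |c|], which exceeds
   [beta |c| r_i] in the limit because [r_i < 1] as soon as there are two
   colors. *)
Lemma urn_gap (R : realType) (m : nat) (Phi : set 'rV[R]_m) (c : int)
    (N : nat -> nat) (beta : R) (r : 'rV[R]_m) :
  Phi `<=` @full_pmf R m -> full_pmf r -> c != 0 -> (c < 0 -> (1 < m)%N) ->
  0 < beta -> (n%:R / (N n)%:R : R) @[n --> \oo] --> beta ->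
  (forall n, (0 < n)%N -> forall q, urn_restrict Phi (N n) q ->
     polya_admissible c n (N n) q) ->
  exists d : 'I_m -> R, (forall i, 0 < d i) /\
    \forall n \near \oo, forall q, urn_restrict Phi (N n) q ->
      forall i, d i <= q 0 i + beta * c%:~R * r 0 i.
Proof.
move=> hPhi [r0 r1] c0 hm b0 hb hadm.
have [cpos|cneg] := ltP 0 c.
  exists (fun i => beta * c%:~R * r 0 i); split=> [i|].
    by rewrite !mulr_gt0 // ltr0z.
  by apply: nearW => n q [/hPhi [q0 _] _] i; rewrite lerDr ltW.
have {}cneg : c < 0 by rewrite lt_neqAle c0.
have cR : c%:~R < 0 :> R by rewrite ltrz0.
have rlt i : r 0 i < 1 by apply: full_pmf_lt1; [exact: hm|split].
(* Eventually [n / N >= beta (1 + r_i) / 2], so admissibility gives [q_i >= beta |c| (1 + r_i) / 2];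
   subtracting [beta |c| r_i] leaves this value. *)
exists (fun i => beta * - c%:~R * ((1 - r 0 i) / 2)); split=> [i|].
  by rewrite !mulr_gt0 ?oppr_gt0 ?divr_gt0 ?subr_gt0.
have hbi : \forall n \near \oo, forall i, beta * ((1 + r 0 i) / 2) <= n%:R / (N n)%:R.
  apply: filter_forall => i; apply: (cvgr_ge _ hb).
  by rewrite gtr_pMr //; have := rlt i; lra.
have hN := near_pos_of_ratio b0 hb.
near=> n.
have n0 : (0 < n)%N by near: n; exists 1%N.
have [N0 _] : (0 < N n)%N /\ (N n)%:R <= 2 / beta * n%:R by near: n.
have hi : forall i, beta * ((1 + r 0 i) / 2) <= n%:R / (N n)%:R by near: n.
move=> q hq i; have N0' : 0 < (N n)%:R :> R by rewrite ltr0n.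
have := hadm n n0 q hq i; rewrite -mulrN -ler_pdivrMl // mulrA => h.
have : beta * ((1 + r 0 i) / 2) * - c%:~R <= (N n)%:R^-1 * n%:R * - c%:~R.
  by rewrite ler_pM2r ?oppr_gt0 // [_^-1 * _]mulrC.
by nra.
Unshelve. all: by end_near. Qed.

(* Points of [Phi] need not lie in any [Phi(N)], but [prior_charges] makes them
   limits of such points. *)
Lemma polya_pos (R : realType) (m : nat) (Phi : set 'rV[R]_m) (c : int)
    (N : nat -> nat) (prior : nat -> 'rV[R]_m -> R) (beta : R) (r : 'rV[R]_m) :
  Phi `<=` @full_pmf R m -> full_pmf r -> (c < 0 -> (1 < m)%N) ->
  0 < beta -> (n%:R / (N n)%:R : R) @[n --> \oo] --> beta ->
  (forall n, (0 < n)%N -> forall q, urn_restrict Phi (N n) q ->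
     polya_admissible c n (N n) q) ->
  prior_charges Phi N prior ->
  forall q, Phi q -> forall i, 0 < q 0 i + beta * c%:~R * r 0 i.
Proof.
move=> hPhi hr hm b0 hb hadm hch q Pq i.
have [q0 _] := hPhi _ Pq.
have [->|c0] := eqVneq c 0; first by rewrite mulr0 mul0r addr0.
have [d [d0 hd]] := urn_gap hPhi hr c0 hm b0 hb hadm.
apply: (lt_le_trans (d0 i)); rewrite leNgt; apply/negP => lt.
(* The gap fails throughout [V], so [V] eventually misses [Phi(N)] and has mass [0], whereas
   [prior_charges] gives it mass at least [expR (- n)]. *)
pose V := [set p : 'rV[R]_m | p 0 i < d i - beta * c%:~R * r 0 i].
have nV : nbhs q V.
  have cq : (p 0 i : R) @[p --> q] --> q 0 i by exact: coord_continuous.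
  have lt' : q 0 i < d i - beta * c%:~R * r 0 i by lra.
  exact: (cvgr_lt _ cq _ lt').
have [n [h1 h2]] : exists n, expR (- (1 * n%:R)) <=
      \sum_(q' \in V `&` urn_restrict Phi (N n)) prior (N n) q' /\
   forall q, urn_restrict Phi (N n) q ->
      forall i, d i <= q 0 i + beta * c%:~R * r 0 i.
  apply: (@filter_ex _ (\oo : set_system nat)).
  by apply: filterI => //; exact: (hch q Pq V nV 1 ltr01).
have V0 : V `&` urn_restrict Phi (N n) = set0.
  rewrite -subset0 => p [/= Vp Up]; have := h2 p Up i.
  by rewrite /V /= in Vp; lra.
by move: h1; rewrite V0 fsbig_set0 leNgt expR_gt0.
Qed.

Lemma cvg_polya_L (R : realType) (m : nat) (c : int) (beta : R)
    (q p : 'rV[R]_m) :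
  (forall i, 0 < q 0 i) -> (forall i, 0 < q 0 i + beta * c%:~R * p 0 i) ->
  polya_L c beta q' p @[q' --> q] --> polya_L c beta q p.
Proof.
move=> q0 qp0; have FF := nbhs_filter q.
have cq i : (fun q' : 'rV[R]_m => q' 0 i) @ q --> q 0 i by exact: coord_continuous.
have csum (F : 'I_m -> 'rV[R]_m -> R) :
    (forall i, F i q' @[q' --> q] --> F i q) ->
    \sum_i F i q' @[q' --> q] --> \sum_i F i q.
  by move=> hF; apply: cvg_big => [|i _]; [exact: add_continuous|exact: hF].
have cln (f : 'rV[R]_m -> R) : f q' @[q' --> q] --> f q -> 0 < f q ->
    ln (f q') @[q' --> q] --> ln (f q).
  by move=> hf f0; exact: (cvg_comp _ _ hf (continuous_ln f0)).
rewrite /polya_L; case: (c == 0) => /=.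
  have h1 := csum (fun i q' => p 0 i * ln (q' 0 i))
    (fun i => cvgMl_tmp (FF := FF) (a := p 0 i) (cln (fun q' => q' 0 i) (cq i) (q0 i))).
  exact: cvgB (cvgN h1) (cvg_cst _).
have cqp i : (fun q' : 'rV[R]_m => q' 0 i + beta * c%:~R * p 0 i) @ q -->
    q 0 i + beta * c%:~R * p 0 i by exact: cvgD (cq i) (cvg_cst _).
have h1 := csum (fun i q' => p 0 i * ln (q' 0 i + beta * c%:~R * p 0 i))
  (fun i => cvgMl_tmp (FF := FF) (a := p 0 i)
    (cln (fun q' => q' 0 i + beta * c%:~R * p 0 i) (cqp i) (qp0 i))).
have cqd i :
    (fun q' : 'rV[R]_m => q' 0 i / (q' 0 i + beta * c%:~R * p 0 i)) @ q -->
    q 0 i / (q 0 i + beta * c%:~R * p 0 i).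
  by apply: cvgM (cq i) _; apply: cvgV (cqp i); rewrite gt_eqF.
have h2 := csum
  (fun i q' => q' 0 i * ln (q' 0 i / (q' 0 i + beta * c%:~R * p 0 i)))
  (fun i => cvgM (FF := FF) (cq i)
    (cln (fun q' => q' 0 i / (q' 0 i + beta * c%:~R * p 0 i)) (cqd i)
      (divr_gt0 (q0 i) (qp0 i)))).
exact: cvgD (cvgN h1) (cvgMl_tmp (FF := FF) (a := (beta * c%:~R)^-1) h2).
Qed.

(* The error is relative because for [c = 0] the divergence is unbounded near
   the boundary of the simplex. *)
Lemma urn_loglik_uniform (R : realType) (m : nat) (Phi : set 'rV[R]_m) (c : int)
    (N : nat -> nat) (beta : R) (r : 'rV[R]_m) (k : nat -> 'I_m -> nat) :
  Phi `<=` @full_pmf R m -> full_pmf r -> (c < 0 -> (1 < m)%N) ->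
  0 < beta -> (n%:R / (N n)%:R : R) @[n --> \oo] --> beta ->
  (forall n, (0 < n)%N -> forall q, urn_restrict Phi (N n) q ->
     polya_admissible c n (N n) q) ->
  (forall n i, (k n i <= n)%N) ->
  (forall i, ((k n i)%:R / n%:R : R) @[n --> \oo] --> r 0 i) ->
  forall e : R, 0 < e -> \forall n \near \oo,
    forall q, urn_restrict Phi (N n) q ->
      `|urn_loglik c n (N n) (k n) q - (- polya_L c beta q r - 1)|
        <= e * (1 + `|- polya_L c beta q r - 1|).
Proof.
move=> hPhi hr hm b0 hb hadm kn hk e e0.
have [r0 r1] := hr.
have [c0|c0] := eqVneq c 0.
  rewrite {}c0.
  (* Since [r_i > 0], the frequency error can be taken relative to [r_i]; summed against [- ln q_i]
     it becomes [e] times the absolute value of the limit. *)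
  have hkr : \forall n \near \oo, forall i, `|r 0 i - (k n i)%:R / n%:R| <= e * r 0 i.
    apply: filter_forall => i; move/cvgrPdist_le: (hk i); apply.
    exact: mulr_gt0.
  near=> n => q [/hPhi [q0 q1] _].
  have hn : forall i, `|r 0 i - (k n i)%:R / n%:R| <= e * r 0 i by near: n.
  rewrite polya_L0 /urn_loglik.
  have lnq i : ln (q 0 i) <= 0.
    by apply: ln_le0; apply: pmf_entry_le1 => // j; exact: ltW.
  have -> : `|\sum_i r 0 i * ln (q 0 i)| = \sum_i r 0 i * - ln (q 0 i).
    rewrite ler0_norm; first by rewrite -sumrN; apply: eq_bigr => i _; rewrite mulrN.
    by apply: sumr_le0 => i _; rewrite mulr_ge0_le0 // ltW.
  apply: (@le_trans _ _ (e * \sum_i r 0 i * - ln (q 0 i))); last first.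
    by rewrite ler_pM2l // lerDr.
  rewrite -sumrB mulr_sumr; apply: (le_trans (ler_norm_sum _ _ _)).
  apply: ler_sum => i _.
  under eq_bigr => l _ do rewrite mul0r mulr0 addr0.
  rewrite sumr_const card_ord -[ln _ *+ _]mulr_natl.
  have -> : n%:R^-1 * ((k n i)%:R * ln (q 0 i)) - r 0 i * ln (q 0 i) =
    ((k n i)%:R / n%:R - r 0 i) * ln (q 0 i) by ring.
  rewrite normrM (ler0_norm (lnq i)).
  by rewrite mulrA ler_wpM2r ?oppr_ge0 // distrC.
have [d [d0 hd]] := urn_gap hPhi hr c0 hm b0 hb hadm.
have e' : 0 < e / m.+1%:R by rewrite divr_gt0.
have cR : c%:~R != 0 :> R by rewrite intr_eq0.
have hu : \forall n \near \oo, forall i s, (N n)%:R^-1 <= s <= 1 ->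
    d i <= s + beta * c%:~R * r 0 i ->
    `|n%:R^-1 * \sum_(l < k n i) ln (s + l%:R * (c%:~R / (N n)%:R))
      - (beta * c%:~R)^-1 * (xlnx (s + beta * c%:~R * r 0 i) - xlnx s)|
    <= e / m.+1%:R.
  apply: filter_forall => i.
  exact: (@polya_log_uniform R c%:~R beta (r 0 i) (d i) N (fun n => k n i)).
near=> n => q hq.
have hn : forall i s, (N n)%:R^-1 <= s <= 1 ->
    d i <= s + beta * c%:~R * r 0 i ->
    `|n%:R^-1 * \sum_(l < k n i) ln (s + l%:R * (c%:~R / (N n)%:R))
      - (beta * c%:~R)^-1 * (xlnx (s + beta * c%:~R * r 0 i) - xlnx s)|
    <= e / m.+1%:R by near: n.
have hdn : forall q, urn_restrict Phi (N n) q ->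
  forall i, d i <= q 0 i + beta * c%:~R * r 0 i by near: n.
have [/hPhi [q0 q1] Uq] := hq.
apply: (@le_trans _ _ e); last by rewrite ler_pMr // lerDl.
have qp0 i : 0 < q 0 i + beta * c%:~R * r 0 i.
  by apply: lt_le_trans (hdn q hq i).
rewrite (polya_L_xlnx c0 (lt0r_neq0 b0) r1 q0 qp0).
rewrite /urn_loglik -sumrB; apply: (le_trans (ler_norm_sum _ _ _)).
apply: (@le_trans _ _ (\sum_(i < m) e / m.+1%:R)).
  apply: ler_sum => i _; apply: hn; last exact: hdn.
  rewrite (urn_config_entry Uq) //=.
  by apply: pmf_entry_le1 => // j; exact: ltW.
rewrite sumr_const card_ord -[leLHS]mulr_natr -mulrA ger_pMr //.
by rewrite mulrC ler_pdivrMr // mul1r ler_nat.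
Unshelve. all: by end_near. Qed.

(** Keeps the infimum of the divergence above [-oo]. For [c = 0] the logarithms are nonpositive;
    otherwise [xlnx] is bounded on []0, 1 + |beta c|]]. *)
Lemma polya_L_lower_bound (R : realType) (m : nat) (Phi : set 'rV[R]_m) (c : int)
    (beta : R) (r : 'rV[R]_m) :
  Phi `<=` @full_pmf R m -> full_pmf r -> 0 < beta ->
  (forall q, Phi q -> forall i, 0 < q 0 i + beta * c%:~R * r 0 i) ->
  exists K, forall q, Phi q -> - polya_L c beta q r - 1 <= K.
Proof.
move=> hPhi [r0 r1] b0 pos.
have [->|c0] := eqVneq c 0.
  exists 0 => q /hPhi [q0 q1]; rewrite polya_L0; apply: sumr_le0 => i _.
  rewrite mulr_ge0_le0 ?(ltW (r0 i)) // ln_le0 //.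
  by apply: pmf_entry_le1 => // j; exact: ltW.
pose a := beta * c%:~R : R.
pose B := 1 + `|a|.
pose C := 1 + B * `|ln B|.
exists (\sum_(i < m) `|a^-1| * (C + C)) => q Pq; have [q0 q1] := hPhi _ Pq.
rewrite (polya_L_xlnx c0 (lt0r_neq0 b0) r1 q0 (pos q Pq)).
apply: ler_sum => i _; apply: (le_trans (ler_norm _)).
rewrite normrM ler_wpM2l //.
have qi : q 0 i <= 1 by apply: pmf_entry_le1 => // j; exact: ltW.
have ri : r 0 i <= 1 by apply: pmf_entry_le1 => // j; exact: ltW.
have a0 := normr_ge0 a.
apply: (le_trans (ler_normB _ _)); apply: lerD; apply: xlnx_bounded.
  rewrite pos //= lerD //; apply: (le_trans (ler_norm _)).
  by rewrite normrM (gtr0_norm (r0 i)) ler_piMr.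
by rewrite q0 /= (le_trans qi) // lerDl.
Qed.

(** Serves both the numerator, [A = Q], and the denominator, [A = Phi], of the posterior. [h] is the
    supremum of [H] over [A]; relative openness keeps in [A] the points of [Phi(N)] near an almost
    maximizer, which the prior charges. *)
Lemma prior_mass_limit (R : realType) (m : nat) (Phi A : set 'rV[R]_m) (c : int)
    (N : nat -> nat) (prior : nat -> 'rV[R]_m -> R) (beta h : R)
    (r : 'rV[R]_m) (k : nat -> 'I_m -> nat) :
  Phi `<=` @full_pmf R m -> full_pmf r -> (c < 0 -> (1 < m)%N) ->
  0 < beta -> (n%:R / (N n)%:R : R) @[n --> \oo] --> beta ->
  (forall n, (0 < n)%N -> forall q, urn_restrict Phi (N n) q ->
     polya_admissible c n (N n) q) ->
  (forall n, (0 < n)%N ->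
     prior_with_support (urn_restrict Phi (N n)) (prior (N n))) ->
  prior_charges Phi N prior ->
  (forall n i, (k n i <= n)%N) ->
  (forall i, ((k n i)%:R / n%:R : R) @[n --> \oo] --> r 0 i) ->
  A `<=` Phi ->
  (forall q, A q -> exists2 U : set 'rV[R]_m, nbhs q U & U `&` Phi `<=` A) ->
  (forall q, A q -> - polya_L c beta q r - 1 <= h) ->
  (forall e : R, 0 < e -> exists2 q, A q & h - e < - polya_L c beta q r - 1) ->
  forall e : R, 0 < e -> \forall n \near \oo,
    let S := \sum_(q \in A `&` urn_restrict Phi (N n))
      (prior (N n) q * expR (n%:R * urn_loglik c n (N n) (k n) q)) in
    0 < S /\ `|n%:R^-1 * ln S - h| <= e.
Proof.
move=> hPhi hr hm b0 hb hadm hpr hch kn hk AP Aop Ah hA.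
have unif := urn_loglik_uniform hPhi hr hm b0 hb hadm kn hk.
pose H q := - polya_L c beta q r - 1.
apply: (@laplace_principle R _ A (fun n => urn_restrict Phi (N n))
  (fun n => prior (N n)) (fun n => urn_loglik c n (N n) (k n)) h).
- near=> n; have n0 : (0 < n)%N by near: n; exists 1%N.
  have [p0 _ p1] := hpr n n0; split => //; last by rewrite p1.
  by apply: finite_setIr; exact: finite_urn_config.
(* For [e' <= 1] the map sending [x] to [x + e' (1 + |x|)] is nondecreasing, so the upper bound is
   largest at [x = h], however negative [H] may become. *)
- move=> e e0; pose e' := e / (1 + `|h| + e).
  have D0 : 0 < 1 + `|h| + e by have := normr_ge0 h; lra.
  have e'0 : 0 < e' by rewrite divr_gt0.
  have e'1 : e' <= 1 by rewrite ler_pdivrMr // mul1r; have := normr_ge0 h; lra.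
  have e'h : e' * (1 + `|h|) <= e.
    rewrite /e' mulrAC ler_pdivrMr // ler_pM2l //; lra.
  near=> n => q [Aq Dq].
  have : `|urn_loglik c n (N n) (k n) q - H q| <= e' * (1 + `|H q|).
    by move: q Dq {Aq}; near: n; exact: unif.
  have := Ah q Aq; rewrite -/(H q) ler_norml => Hh /andP[_ hi].
  have hn := ler_norm h.
  have := normr_ge0 h.
  have [H0|H0] := leP 0 (H q).
    by rewrite (ger0_norm H0) in hi; nra.
  rewrite (ltr0_norm H0) in hi.
  have p1 : 0 <= (1 - e') * (h - H q) by rewrite mulr_ge0 // subr_ge0.
  have p2 : e' * (- h) <= e' * `|h|.
    by rewrite ler_pM2l //; have := ler_norm (- h); rewrite normrN.
  by move: hi e'h p1 p2; rewrite !mulrDr !mulrDl !mulr1 => *; lra.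
- move=> e e0; have e4 : 0 < e / 4 by rewrite divr_gt0.
  have [q Aq hq] := hA _ e4.
  have [V nV VA] := Aop q Aq.
  have Pq := AP _ Aq; have [q0 _] := hPhi _ Pq.
  have pos := polya_pos hPhi hr hm b0 hb hadm hch Pq.
  have cL := cvg_polya_L q0 pos.
  (* On [W], [H] exceeds [H q - e / 4], hence [h - e / 2]; the other [e / 2] is left for the error
     of the log-likelihood. *)
  pose W := [set q' | polya_L c beta q' r < polya_L c beta q r + e / 4].
  have nW : nbhs q W by apply: (cvgr_lt _ cL); rewrite ltrDl.
  have nVW : nbhs q (V `&` W) by exact: filterI.
  exists (V `&` W).
  have D0 : 0 < 1 + `|h| + e by have := normr_ge0 h; lra.
  pose e' := e / 2 / (1 + `|h| + e).
  have e'0 : 0 < e' by rewrite !divr_gt0.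
  have e'h : e' * (1 + `|h| + e) = e / 2 by rewrite divfK // gt_eqF.
  near=> n; split; last by near: n; exact: (hch q Pq).
  move=> p [[Vp Wp] Dp]; have Ap : A p by apply: VA; split=> //; case: Dp.
  split=> //.
  have : `|urn_loglik c n (N n) (k n) p - H p| <= e' * (1 + `|H p|).
    by move: p Dp {Vp Wp Ap}; near: n; exact: unif.
  have := Ah p Ap; rewrite -/(H p) ler_norml => Hh /andP[lo _].
  have Hp : h - e / 2 <= H p by move: Wp hq; rewrite /W /H /=; lra.
  have hn := ler_norm h; have hn' := ler_norm (- h); rewrite normrN in hn'.
  have Hn : `|H p| <= `|h| + e by rewrite ler_norml; apply/andP; split; lra.
  have : e' * (1 + `|H p|) <= e' * (1 + `|h| + e) by rewrite ler_pM2l //; lra.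
  lra.
Unshelve. all: by end_near. Qed.

(** * Posterior *)

Lemma urn_term_ge0 (R : realType) (m : nat) (c : int) (n M : nat)
    (q : 'rV[R]_m) i l :
  0 <= q 0 i -> polya_admissible c n M q -> (l < n)%N ->
  0 <= M%:R * q 0 i + l%:R * c%:~R.
Proof.
move=> q0 adm ln; have [c0|c0] := leP 0 c.
  by rewrite addr_ge0 // mulr_ge0 // ler0z.
have cR : c%:~R < 0 :> R by rewrite ltrz0.
have lR : l%:R <= n%:R :> R by rewrite ler_nat ltnW.
have := adm i; nra.
Qed.

Lemma urn_term_gt0 (R : realType) (m : nat) (c : int) (n M : nat)
    (q : 'rV[R]_m) i l :
  (0 < M)%N -> 0 < q 0 i -> polya_admissible c n M q -> (l < n)%N ->
  0 < M%:R * q 0 i + l%:R * c%:~R.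
Proof.
move=> M0 q0 adm ln; have [c0|c0] := leP 0 c.
  by rewrite ltr_pwDl ?mulr_gt0 ?ltr0n // mulr_ge0 // ler0z.
have cR : c%:~R < 0 :> R by rewrite ltrz0.
have lR : l%:R < n%:R :> R by rewrite ltr_nat.
have := adm i; nra.
Qed.

Lemma urn_total_gt0 (R : realType) (m : nat) (c : int) (n M : nat)
    (q : 'rV[R]_m) l :
  (0 < M)%N -> full_pmf q -> polya_admissible c n M q -> (l < n)%N ->
  0 < M%:R + l%:R * c%:~R :> R.
Proof.
case: m q => [|m] q M0 [q0 q1] adm ln.
  by move: q1; rewrite big_ord0 => /esym/eqP; rewrite oner_eq0.
apply: (lt_le_trans (urn_term_gt0 M0 (q0 ord0) adm ln)).
rewrite lerD2r ger_pMr ?ltr0n //.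
by apply: pmf_entry_le1 => // j; exact: ltW.
Qed.

Lemma polya_posterior_loglik (R : realType) (m : nat) (Phi Q : set 'rV[R]_m)
    (c : int) (n M : nat) (prior : 'rV[R]_m -> R) (x : n.-tuple 'I_m) :
  Phi `<=` @full_pmf R m -> urn_restrict Phi M !=set0 -> (0 < n)%N ->
  (forall q, urn_restrict Phi M q -> polya_admissible c n M q) ->
  let S A := \sum_(q \in A `&` urn_restrict Phi M) (prior q *
    expR (n%:R * urn_loglik c n M (fun i => count_mem i x) q)) in
  polya_posterior Phi c M prior x Q = S Q / S Phi.
Proof.
move=> hPhi [p hp] n0 hadm /=.
have M0 : (0 < M)%N by have [_ []] := hp.
pose C := M%:R ^+ n / \prod_(l < n) (M%:R + l%:R * c%:~R) : R.
have C0 : C != 0.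
  apply: lt0r_neq0; rewrite divr_gt0 ?exprn_gt0 ?ltr0n // prodr_gt0 // => l _.
  by apply: (urn_total_gt0 M0 _ (hadm p hp)) => //; apply: hPhi; case: hp.
have sumE (A : set 'rV[R]_m) :
    \sum_(q \in A `&` urn_restrict Phi M) (prior q * polya_prob c M q x) =
    C * \sum_(q \in A `&` urn_restrict Phi M) (prior q *
      expR (n%:R * urn_loglik c n M (fun i => count_mem i x) q)).
  rewrite mulr_fsumr; apply: eq_fsbigr => q /set_mem [_ Uq].
  rewrite polya_prob_loglik -/C //; first by rewrite mulrCA.
  move=> i l li; have [q0 _] := hPhi q Uq.1.
  apply: (urn_term_gt0 M0 (q0 i) (hadm q Uq)).
  by apply: (leq_trans li); rewrite -[X in (_ <= X)%N](size_tuple x) count_size.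
rewrite /polya_posterior sumE.
(* The normalizer is put in the form [S Phi], so that one identity treats both sums. *)
rewrite -[X in _ / (\sum_(q \in X) _)](_ : Phi `&` urn_restrict Phi M = _).
  by rewrite sumE invfM mulrACA divff // mul1r.
by rewrite /urn_restrict setIA setIid.
Qed.

Lemma subspace_open_nbhs (T : topologicalType) (D E Q : set T) :
  E `<=` D -> Q `<=` E -> open (Q : set (subspace D)) ->
  forall q, Q q -> exists2 U : set T, nbhs q U & U `&` E `<=` Q.
Proof.
move=> ED QE /open_subspaceP [V oV VD] q Qq.
exists V.
  apply: open_nbhs_nbhs; split => //.
  have : (Q `&` D) q by split=> //; exact/ED/QE.
  by rewrite -VD => -[].
move=> p [Vp Ep]; have : (V `&` D) p by split=> //; exact: ED.
by rewrite VD => -[].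
Qed.

(** Trades the extended infimum of [L] for the real supremum [h] of [H]: the bound [K] excludes
    [-oo], and the two properties of [h] are those that [prior_mass_limit] consumes. *)
Lemma polya_L_inf_fin (R : realType) (m : nat) (c : int) (beta : R)
    (A : set 'rV[R]_m) (r : 'rV[R]_m) (K : R) :
  (polya_L_inf c beta A r < +oo)%E ->
  (forall q, A q -> - polya_L c beta q r - 1 <= K) ->
  exists h, [/\ polya_L_inf c beta A r = (- h - 1)%:E,
    forall q, A q -> - polya_L c beta q r - 1 <= h
    & forall e : R, 0 < e -> exists2 q, A q & h - e < - polya_L c beta q r - 1].
Proof.
move=> fin hK.
have lo : ((- K - 1)%:E <= polya_L_inf c beta A r)%E.
  by apply: le_ereal_inf_tmp => _ [q Aq <-]; rewrite lee_fin; have := hK q Aq; lra.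
have fn : polya_L_inf c beta A r \is a fin_num.
  by rewrite fin_numElt fin andbT (lt_le_trans _ lo) // ltNyr.
exists (- fine (polya_L_inf c beta A r) - 1); split.
- by rewrite -[LHS]fineK //; congr EFin; ring.
- move=> q Aq.
  have : (polya_L_inf c beta A r <= (polya_L c beta q r)%:E)%E.
    by apply: ereal_inf_lbound; exists q.
  by rewrite -[X in (X <= _)%E]fineK // lee_fin; lra.
- move=> e e0; have [_ [q Aq <-]] := lb_ereal_inf_adherent e0 fn.
  rewrite -/(polya_L_inf _ _ _ _) -[X in (X + _)%E]fineK // -EFinD lte_fin => hq.
  by exists q => //; lra.
Qed.

Lemma full_pmf_unique (R : realType) (m : nat) (p q : 'rV[R]_m) :
  (m <= 1)%N -> full_pmf p -> full_pmf q -> p = q.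
Proof.
case: m p q => [|[|//]] p q _ [_ p1] [_ q1]; apply/rowP => i.
  by case: i.
by move: p1 q1; rewrite !big_ord1 !ord1 => -> ->.
Qed.

Lemma tv_dist_coord (R : realType) (m : nat) (p q : 'rV[R]_m) i :
  `|p 0 i - q 0 i| <= 2 * tv_dist p q.
Proof. by rewrite mulrA divff // mul1r (bigD1 i) //= lerDl sumr_ge0. Qed.

(** For [c >= 0] the lower bound comes from [beta < 1]. For [c < 0], admissibility in two distinct
    colors gives [N >= 2 n |c|], so at least [n |c| >= n] balls remain after [l <= n] draws. *)
Lemma polya_total_bounds (R : realType) (m : nat) (c : int) (N : nat -> nat)
    (r_ : nat -> 'rV[R]_m) (beta : R) :
  (1 < m)%N -> 0 < beta < 1 ->
  (n%:R / (N n)%:R : R) @[n --> \oo] --> beta ->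
  (forall n, (0 < n)%N -> urn_config (N n) (r_ (N n))) ->
  (forall n, (0 < n)%N -> polya_admissible c n (N n) (r_ (N n))) ->
  \forall n \near \oo, (forall l, (l <= n)%N ->
      n%:R <= (N n)%:R + l%:R * c%:~R :> R) /\
    (N n)%:R + n%:R * c%:~R <= (2 / beta + c%:~R) * n%:R.
Proof.
move=> m1 /andP[b0 b1] hb hr_ hadm.
have hN := near_pos_of_ratio b0 hb.
have hlt : \forall n \near \oo, n%:R / (N n)%:R < 1 :> R.
  by apply: (cvgr_lt _ hb).
near=> n.
have n0 : (0 < n)%N by near: n; exists 1%N.
have [N0 NB] : (0 < N n)%N /\ (N n)%:R <= 2 / beta * n%:R by near: n.
have n1 : n%:R / (N n)%:R < 1 :> R by near: n.
have {}n1 : n%:R <= (N n)%:R :> R.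
  by rewrite ltW //; rewrite ltr_pdivrMr ?ltr0n // mul1r in n1.
split; last by rewrite mulrDl [_ * n%:R]mulrC [X in _ + X]mulrC lerD // mulrC.
move=> l ln; have lR : l%:R <= n%:R :> R by rewrite ler_nat.
have [c0|c0] := leP 0 c.
  by rewrite (le_trans n1) // lerDl mulr_ge0 // ler0z.
have cR := intr_leN1 R c0.
have /card_gt1P[i [j [_ _ ij]]] : (1 < #|'I_m|)%N by rewrite card_ord.
have q1 := urn_config_sum (hr_ n n0).
have : r_ (N n) 0 i + r_ (N n) 0 j <= 1.
  rewrite -q1 (bigD1 i) //= (bigD1 j) 1?eq_sym //= addrA lerDl sumr_ge0 // => s _.
  exact: urn_config_ge0 (hr_ n n0).
have := hadm n n0 i; have := hadm n n0 j.
have : 0 < (N n)%:R :> R by rewrite ltr0n.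
have : 0 <= n%:R :> R by [].
have : 0 <= l%:R :> R by [].
set x := r_ _ 0 i; set y := r_ _ 0 j.
move=> l0 nn0 NN aj ai xy.
have : (N n)%:R * (x + y) <= (N n)%:R by rewrite ger_pMr.
rewrite mulrDr => s.
have : n%:R * c%:~R <= l%:R * c%:~R :> R by rewrite ler_wnM2r //; lra.
have : n%:R * c%:~R <= - n%:R :> R by rewrite -mulrN1 ler_wpM2l.
lra.
Unshelve. all: by end_near. Qed.

(** The point is that the normalizer is nonzero: the prior has total mass [1], so [Phi(N)] is
    nonempty, and every term of the sum is positive there. *)
Lemma polya_posterior_self (R : realType) (m : nat) (Phi : set 'rV[R]_m)
    (c : int) (n M : nat) (prior : 'rV[R]_m -> R) (x : n.-tuple 'I_m) :
  Phi `<=` @full_pmf R m -> (0 < n)%N ->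
  (forall q, urn_restrict Phi M q -> polya_admissible c n M q) ->
  prior_with_support (urn_restrict Phi M) prior ->
  polya_posterior Phi c M prior x Phi = 1.
Proof.
move=> hPhi n0 hadm [p0 psupp p1].
have ne : urn_restrict Phi M !=set0.
  apply/set0P/eqP => E; move: p1; rewrite E fsbig_set0 => /esym/eqP.
  by rewrite oner_eq0.
rewrite polya_posterior_loglik // divff //.
have [q hq] := ne; apply/eqP => /pfsumr_eq0 => E.
have /eqP : prior q * expR (n%:R * urn_loglik c n M (fun i => count_mem i x) q) = 0.
  apply: E; first by apply: finite_setIr; apply: finite_setIr; exact: finite_urn_config.
    by move=> p _; rewrite mulr_ge0 ?expR_ge0.
  by split=> //; case: hq.
by rewrite mulf_eq0 expR_eq0 orbF; apply/negP; apply/psupp.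
Qed.

Theorem theorem2p4 (R : realType) (m : nat)
  (d : measure_display) (Omega : measurableType d) (P : probability Omega R)
  (Phi Q : set 'rV[R]_m)
  (hPhi : Phi `<=` @full_pmf R m)
  (hQPhi : Q `<=` Phi)
  (hQ : open (Q : set (subspace (@full_pmf R m))))
  (c : int) (N : nat -> nat) (r_ : nat -> 'rV[R]_m) (r : 'rV[R]_m) (beta : R)
  (X : forall n : nat, Omega -> n.-tuple 'I_m)
  (prior : nat -> 'rV[R]_m -> R)
  (hr_ : forall n, (0 < n)%N -> urn_config (N n) (r_ (N n)))
  (hadm_r : forall n, (0 < n)%N -> polya_admissible c n (N n) (r_ (N n)))
  (hadm_Phi : forall n, (0 < n)%N -> forall q, urn_restrict Phi (N n) q ->
     polya_admissible c n (N n) q)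
  (hX : polya_samples P c N r_ X)
  (hprior : forall n, (0 < n)%N ->
     prior_with_support (urn_restrict Phi (N n)) (prior (N n)))
  (hcharge : prior_charges Phi N prior)
  (hbeta : 0 < beta < 1)
  (hbetan : (n%:R / (N n)%:R : R) @[n --> \oo] --> beta)
  (hr : full_pmf r)
  (hrn : tv_dist (r_ (N n)) r @[n --> \oo] --> (0 : R))
  (hfin : (polya_L_inf c beta Q r < +oo)%E) :
  {ae P, forall w : Omega,
    (n%:R^-1 * ln (polya_posterior Phi c (N n) (prior (N n)) (X n w) Q))%:E
      @[n --> \oo] -->
    (- (polya_L_inf c beta Q r - polya_L_inf c beta Phi r))%E}.
Proof.
have [b0 b1] := andP hbeta.
(* With a single color and [c < 0], [1 + beta c] may vanish; there [Q = Phi]. *)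
have [m1|m1] := leqP m 1.
  (* An empty [Q] would have infimum [+oo], against [hfin]. *)
  have [q0 [Qq0 _]] : exists q, Q q /\ True.
    apply: contrapT => nQ; suff Q0 : Q = set0.
      by move: hfin; rewrite /polya_L_inf Q0 image_set0 ereal_inf0 ltxx.
    by rewrite -subset0 => q Qq; apply: nQ; exists q.
  have E : Q = Phi.
    apply/seteqP; split=> // p Pp.
    by rewrite (full_pmf_unique m1 (hPhi p Pp) (hPhi q0 (hQPhi _ Qq0))).
  have [h [hL _ _]] : exists h, [/\ polya_L_inf c beta Q r = (- h - 1)%:E,
      forall q, Q q -> - polya_L c beta q r - 1 <= h &
      forall e : R, 0 < e -> exists2 q, Q q & h - e < - polya_L c beta q r - 1].
    apply: (@polya_L_inf_fin _ _ _ _ _ _ (- polya_L c beta q0 r - 1)) => // q Qq.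
    by rewrite (full_pmf_unique m1 (hPhi q (hQPhi _ Qq)) (hPhi q0 (hQPhi _ Qq0))).
  subst Phi; rewrite hL subee // oppe0.
  apply: nearW => w; apply: cvg_near_cst; near=> n.
  have n0 : (0 < n)%N by near: n; exists 1%N.
  rewrite (polya_posterior_self _ hPhi n0 (hadm_Phi n n0) (hprior n n0)).
  by rewrite ln1 mulr0.
have pos := polya_pos hPhi hr (fun _ => m1) b0 hbetan hadm_Phi hcharge.
have [K hK] := polya_L_lower_bound hPhi hr b0 pos.
have hfinPhi : (polya_L_inf c beta Phi r < +oo)%E.
  apply: le_lt_trans hfin; apply: ereal_inf_le_tmp.
  by move=> _ [q Qq <-]; exists q => //; exact: hQPhi.
have [hq [hqL hq1 hq2]] := polya_L_inf_fin hfin (fun q Qq => hK q (hQPhi q Qq)).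
have [hp [hpL hp1 hp2]] := polya_L_inf_fin hfinPhi hK.
have freq := polya_frequency_ae hX (fun n n0 => urn_config_sum (hr_ n n0))
  (fun n n0 j l => urn_term_ge0 (urn_config_ge0 j (hr_ n n0)) (hadm_r n n0))
  (polya_total_bounds m1 hbeta hbetan hr_ hadm_r).
apply: filterS freq => w hw.
pose k n i := count_mem i (X n w).
have kn n i : (k n i <= n)%N.
  by rewrite -[X in (_ <= X)%N](size_tuple (X n w)) count_size.
have hk i : ((k n i)%:R / n%:R : R) @[n --> \oo] --> r 0 i.
  apply/cvgrPdist_le => e e0.
  have e2 : 0 < e / 2 by rewrite divr_gt0.
  (* A coordinate differs by at most twice the total variation distance, so [e / 4] there
     contributes [e / 2]. *)
  have e4 : 0 < e / 4 by rewrite divr_gt0.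
  have h1 := hw _ e2 i.
  have h2 : \forall n \near \oo, `|0 - tv_dist (r_ (N n)) r| <= e / 4.
    by move/cvgrPdist_le: hrn; apply.
  near=> n.
  have : `|(k n i)%:R / n%:R - r_ (N n) 0 i| <= e / 2 by near: n.
  have : `|0 - tv_dist (r_ (N n)) r| <= e / 4 by near: n.
  rewrite sub0r normrN => /(le_trans (ler_norm _)).
  have := tv_dist_coord (r_ (N n)) r i.
  rewrite !ler_norml => /andP[? ?] ? /andP[? ?]; apply/andP; split; lra.
have limQ := prior_mass_limit hPhi hr (fun _ => m1) b0 hbetan hadm_Phi hprior
  hcharge kn hk hQPhi (subspace_open_nbhs hPhi hQPhi hQ) hq1 hq2.
have PhiN q : Phi q -> exists2 U : set 'rV[R]_m, nbhs q U & U `&` Phi `<=` Phi.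
  by exists setT; [exact: filterT|move=> p []].
have limP := prior_mass_limit hPhi hr (fun _ => m1) b0 hbetan hadm_Phi hprior
  hcharge kn hk (@subset_refl _ Phi) PhiN hp1 hp2.
rewrite hqL hpL -EFinB -EFinN.
have -> : - (- hq - 1 - (- hp - 1)) = hq - hp by ring.
apply: cvg_EFin; first exact: nearW.
apply/cvgrPdist_le => e e0.
have e2 : 0 < e / 2 by rewrite divr_gt0.
have hQn := limQ _ e2; have hPn := limP _ e2.
near=> n => /=.
have n0 : (0 < n)%N by near: n; exists 1%N.
have [SQ0 SQ] : let S := \sum_(q \in Q `&` urn_restrict Phi (N n))
      (prior (N n) q * expR (n%:R * urn_loglik c n (N n) (k n) q)) in
    0 < S /\ `|n%:R^-1 * ln S - hq| <= e / 2 by near: n.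
have [SP0 SP] : let S := \sum_(q \in Phi `&` urn_restrict Phi (N n))
      (prior (N n) q * expR (n%:R * urn_loglik c n (N n) (k n) q)) in
    0 < S /\ `|n%:R^-1 * ln S - hp| <= e / 2 by near: n.
rewrite polya_posterior_loglik //; last 2 first.
- apply/set0P/negP => /eqP U0; move: SP0.
  by rewrite U0 setI0 fsbig_set0 ltxx.
- exact: hadm_Phi.
rewrite ln_div ?posrE // mulrBr distrC.
move: SQ SP; rewrite !ler_norml => /andP[? ?] /andP[? ?].
by apply/andP; split; lra.
Unshelve. all: by end_near. Qed.
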